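(* Let $\Pi_1,\Pi_2$ be MGC programs. Then $\Pi_1$ and $\Pi_2$ are strongly equivalent (i.e., the infinitary formulas $\tau(\Pi_1)$ and $\tau(\Pi_2)$ are strongly equivalent) if and only if $gr(\tau^*(\Pi_1))$ is equivalent to $gr(\tau^*(\Pi_2))$ in $HT^\infty+gr(\mathit{Defs})$.
   Context: **Precomputed terms and terms.** Fix three disjoint countably infinite sets of symbols: numerals, symbolic constants, variables. Numerals are in a fixed bijection with the integers; $\overline n$ is the numeral of the integer $n$. Precomputed terms are the numerals, the symbolic constants, and two further symbols $\mathit{inf}$, $\mathit{sup}$. A total order on precomputed terms is fixed, with least element $\mathit{inf}$, greatest element $\mathit{sup}$, and with the numerals contiguous and ordered as the integers. Terms are built from precomputed terms and variables using the binary operations $+,-,\times,/,\backslash,..$ (the last one is ''interval''). A term is ground if it has no variables, and interval-free if it does not contain $..$. Every ground term $t$ has a finite set $[t]$ of values, which are precomputed terms: - $[r]=\{r\}$ for a precomputed term $r$; - for $\mathrm{op}\in\{+,-,\times\}$, $[t_1\,\mathrm{op}\,t_2]=\{\overline{m\,\mathrm{op}\,n} : \overline m\in[t_1],\overline n\in[t_2]\}$; - $[t_1/t_2]=\{\overline{\mathrm{trunc}(m/n)} : \overline m\in[t_1],\overline n\in[t_2],n\ne0\}$ and $[t_1\backslash t_2]=\{\overline{m-n\cdot\mathrm{trunc}(m/n)} : \overline m\in[t_1],\overline n\in[t_2],n\neq0\}$, where $\mathrm{trunc}$ rounds toward zero; - $[t_1..t_2]=\{\overline k : \overline m\in[t_1],\overline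 n\in[t_2],m\le k\le n\}$. (Only numeral values participate in the arithmetic cases.) For a tuple $\mathbf t$ of ground terms, $[\mathbf t]$ is the set of tuples $r_1,\dots,r_n$ with $r_i\in[t_i]$. **Rules and programs.** An atom is $p(\mathbf t)$ with $p$ a symbolic constant and $\mathbf t$ a (possibly empty) tuple of terms. A literal is $A$, $\mathit{not}\ A$ or $\mathit{not}\ \mathit{not}\ A$ for an atom $A$. A comparison is $t_1\prec t_2$ with $\prec$ one of $=,\neq,<,>,\le,\ge$. An aggregate element is $\mathbf X:\mathbf L$ where $\mathbf X$ is a tuple of distinct variables and $\mathbf L$ is a conjunction of literals and comparisons in which every member of $\mathbf X$ occurs. An aggregate atom is $\mathit{count}\{\mathbf X:\mathbf L\}\ge t$ or $\mathit{count}\{\mathbf X:\mathbf L\}\le t$ with $t$ an interval-free term. A rule is $\mathit{Head}\leftarrow\mathit{Body}$, where $\mathit{Body}$ is a possibly empty conjunction of literals, comparisons and aggregate atoms and $\mathit{Head}$ is an atom (basic rule), an atom in braces $\{A\}$ (choice rule), or empty (constraint). A variable of a rule is local if all its occurrences are inside aggregate elements, global otherwise. A rule is closed if it has no global variables, and pure if for every aggregate element $\mathbf X:\mathbf L$ in its body all members of $\mathbf X$ are local. An MGC program is a finite set of pure rules. An instance of a pure rule is the closed rule obtained by substituting precomputed terms for all its global variables. **Infinitary propositional formulas** over a set of atoms: atoms are formulas; for a set $\mathcal H$ of formulas, $\mathcal H^\wedge$ and $\mathcal H^\vee$ are formulas; $F\to G$ is a formula. $\bot=\emptyset^\vee$,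 $\top=\emptyset^\wedge$, $\neg F=F\to\bot$, $F\leftrightarrow G=(F\to G)\wedge(G\to F)$. A set $I$ of atoms satisfies formulas in the usual way (infinite conjunction/disjunction as ''all''/''some''). The reduct $F^I$: $\bot$ if $I\not\models F$; otherwise $p^I=p$ for atoms, $(\mathcal H^\wedge)^I=\{G^I:G\in\mathcal H\}^\wedge$, $(\mathcal H^\vee)^I=\{G^I:G\in\mathcal H\}^\vee$, $(F\to G)^I=F^I\to G^I$. $I$ is a stable model of $F$ if $I$ is a minimal (w.r.t. set inclusion) set of atoms satisfying $F^I$. Infinitary formulas $F,G$ are strongly equivalent if for every infinitary formula $H$, $F\wedge H$ and $G\wedge H$ have the same stable models. **The translation $\tau$.** Precomputed atoms are $p(\mathbf r)$ with $\mathbf r$ precomputed terms. For ground $p(\mathbf t)$: $\tau(p(\mathbf t))=\bigvee_{\mathbf r\in[\mathbf t]}p(\mathbf r)$, $\tau(\mathit{not}\ p(\mathbf t))=\bigvee_{\mathbf r\in[\mathbf t]}\neg p(\mathbf r)$, $\tau(\mathit{not}\ \mathit{not}\ p(\mathbf t))=\bigvee_{\mathbf r\in[\mathbf t]}\neg\neg p(\mathbf r)$. $\tau(t_1\prec t_2)$ (ground) is $\top$ if $\prec$ holds between some $r_1\in[t_1]$, $r_2\in[t_2]$, else $\bot$. $\tau$ of a conjunction is the conjunction of the $\tau$'s. For an aggregate atom with ground $t$: if $[t]=\emptyset$ both $\tau(\mathit{count}\{\mathbf X:\mathbf L\}\ge t)$ and $\tau(\mathit{count}\{\mathbf X:\mathbf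 L\}\le t)$ are $\bot$; if $[t]=\{c\}$, $$\tau(\mathit{count}\{\mathbf X:\mathbf L\}\ge t)=\bigvee_{\Delta:\overline{|\Delta|}\ge c}\bigwedge_{\mathbf x\in\Delta}\bigvee_{\mathbf w}\tau(\mathbf L^{\mathbf X,\mathbf W}_{\mathbf x,\mathbf w}),\qquad\tau(\mathit{count}\{\mathbf X:\mathbf L\}\le t)=\bigwedge_{\Delta:\overline{|\Delta|}>c}\neg\bigwedge_{\mathbf x\in\Delta}\bigvee_{\mathbf w}\tau(\mathbf L^{\mathbf X,\mathbf W}_{\mathbf x,\mathbf w}),$$ with $\Delta$ ranging over finite sets of tuples of precomputed terms of the length of $\mathbf X$, $\mathbf W$ the variables of $\mathbf L$ not in $\mathbf X$, $\mathbf w$ over tuples of precomputed terms of the length of $\mathbf W$, $\mathbf L^{\mathbf X,\mathbf W}_{\mathbf x,\mathbf w}$ the substitution result, and comparisons in the fixed order. For closed rules: $\tau(p(\mathbf t)\leftarrow B)=\tau(B)\to\bigwedge_{\mathbf r\in[\mathbf t]}p(\mathbf r)$; $\tau(\{p(\mathbf t)\}\leftarrow B)=\tau(B)\to\bigwedge_{\mathbf r\in[\mathbf t]}(p(\mathbf r)\vee\neg p(\mathbf r))$; $\tau(\leftarrow B)=\neg\tau(B)$. For a program $\Pi$, $\tau(\Pi)$ is the conjunction of $\tau(R')$ over all instances $R'$ of rules of $\Pi$. **First-order target language.** Two sorts: general, and its subsort integer; rule variables are general variables; integer variables range over numerals. Signature $\sigma_0$: all precomputed terms as object constants (sort integer iff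 numerals); $+,-,\times$ as binary function symbols on the integer sort; predicate constants $p/n$ for symbolic constants $p$ ($p(\mathbf t)$ abbreviates $(p/n)(\mathbf t)$); the six comparison symbols as binary predicate constants. $\sigma_1$ adds predicate constants $\mathit{Atleast}^{\mathbf X;\mathbf V}_F$, $\mathit{Atmost}^{\mathbf X;\mathbf V}_F$ for all disjoint lists $\mathbf X,\mathbf V$ of distinct general variables and $\sigma_0$-formulas $F$ with free variables in $\mathbf X$ or $\mathbf V$, each with $|\mathbf V|+1$ general arguments. **$val_t(Z)$** ($I,J,K,Q,R$ fresh integer variables): $val_r(Z)$ is $Z=r$ ($r$ precomputed); $val_X(Z)$ is $Z=X$; for $\mathrm{op}\in\{+,-,\times\}$, $val_{t_1\mathrm{op}t_2}(Z)=\exists IJ(Z=I\,\mathrm{op}\,J\wedge val_{t_1}(I)\wedge val_{t_2}(J))$; $val_{t_1/t_2}(Z)=\exists IJQR(val_{t_1}(I)\wedge val_{t_2}(J)\wedge J\ne\overline0\wedge I=J\times Q+R\wedge R\times I\ge\overline0\wedge R\times R<J\times J\wedge Z=Q)$, and $val_{t_1\backslash t_2}(Z)$ the same with $Z=R$ instead of $Z=Q$; $val_{t_1..t_2}(Z)=\exists IJK(val_{t_1}(I)\wedge val_{t_2}(J)\wedge I\le K\wedge K\le J\wedge Z=K)$; for tuples, $val_{\mathbf t}(\mathbf Z)=\bigwedge_i val_{t_i}(Z_i)$. **$\tau^B$** (fresh general variables): $\tau^B(p(\mathbf t))=\exists\mathbf Z(val_{\mathbf t}(\mathbf Z)\wedge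 p(\mathbf Z))$; $\tau^B(\mathit{not}\ p(\mathbf t))=\exists\mathbf Z(val_{\mathbf t}(\mathbf Z)\wedge\neg p(\mathbf Z))$; $\tau^B(\mathit{not}\ \mathit{not}\ p(\mathbf t))=\exists\mathbf Z(val_{\mathbf t}(\mathbf Z)\wedge\neg\neg p(\mathbf Z))$; $\tau^B(t_1\prec t_2)=\exists Z_1Z_2(val_{t_1}(Z_1)\wedge val_{t_2}(Z_2)\wedge Z_1\prec Z_2)$; conjunctions are translated conjunct-wise. **$\tau^*$.** For a pure rule $H\leftarrow B_1\wedge\dots\wedge B_n$: $B_i^*=\tau^B(B_i)$ for literals and comparisons; if $B_i$ is $\mathit{count}\{\mathbf X:\mathbf L\}\ge t$ (resp. $\le t$), with $\mathbf V$ the global variables of the rule occurring in $\mathbf L$ and $\mathbf W$ the local variables occurring in $\mathbf L$ not in $\mathbf X$, $B_i^*=\exists C(val_t(C)\wedge\mathit{Atleast}^{\mathbf X;\mathbf V}_{\exists\mathbf W\tau^B(\mathbf L)}(\mathbf V,C))$ (resp. $\mathit{Atmost}$), $C$ fresh general. $\tau^*(R)$ is the universal closure of $B_1^*\wedge\dots\wedge B_n^*\wedge val_{\mathbf t}(\mathbf Z)\to p(\mathbf Z)$ if $H=p(\mathbf t)$; of $B_1^*\wedge\dots\wedge B_n^*\wedge val_{\mathbf t}(\mathbf Z)\to p(\mathbf Z)\vee\neg p(\mathbf Z)$ if $H=\{p(\mathbf t)\}$; of $\neg(B_1^*\wedge\dots\wedge B_n^* )$ if $H$ is empty ($\mathbf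 Z$ fresh). $\tau^*(\Pi)$ is the conjunction of $\tau^*(R)$ for $R\in\Pi$. **Counting formulas and Defs.** For a $\sigma_0$-formula $F$, list $\mathbf X$, fresh tuples $\mathbf X_i$ of general variables, and precomputed $r$: $\exists_{\ge r}\mathbf XF$ is $\exists\mathbf X_1\cdots\mathbf X_n(\bigwedge_{i=1}^nF^{\mathbf X}_{\mathbf X_i}\wedge\bigwedge_{i<j}\neg(\mathbf X_i=\mathbf X_j))$ if $r=\overline n,n>0$; $\top$ if $r\le\overline0$; $\bot$ if $r>\overline n$ for all $n$. $\exists_{\le r}\mathbf XF$ is $\forall\mathbf X_1\cdots\mathbf X_{n+1}(\bigwedge_{i=1}^{n+1}F^{\mathbf X}_{\mathbf X_i}\to\bigvee_{i<j}\mathbf X_i=\mathbf X_j)$ if $r=\overline n,n\ge0$; $\bot$ if $r<\overline0$; $\top$ if $r>\overline n$ for all $n$. $\mathit{Defs}$ is the set of all sentences $\forall\mathbf V(\mathit{Atleast}^{\mathbf X;\mathbf V}_F(\mathbf V,r)\leftrightarrow\exists_{\ge r}\mathbf XF)$ and $\forall\mathbf V(\mathit{Atmost}^{\mathbf X;\mathbf V}_F(\mathbf V,r)\leftrightarrow\exists_{\le r}\mathbf XF)$ for all such predicate constants and precomputed $r$. **Grounding $gr$** of $\sigma_1$-sentences (ground terms evaluated by integer arithmetic): $gr(\bot)=\bot$; $gr(t_1\prec t_2)$ is $\top$ if $\prec$ holds between the values, else $\bot$; $gr(p(\mathbf t))$ replaces terms by their values; $gr(F\odot G)=gr(F)\odot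 gr(G)$; $gr(\forall XF)$, $gr(\exists XF)$ are the conjunction, disjunction of $gr(F^X_r)$ over all precomputed terms $r$ ($X$ general) or numerals $r$ ($X$ integer). $gr(\Gamma)=\{gr(F):F\in\Gamma\}$. **$HT^\infty$.** Sequents $\Gamma\Rightarrow F$ ($\Gamma$ finite; $\Rightarrow F$ identified with $F$). Axioms: $F\Rightarrow F$; $F\vee(F\to G)\vee\neg G$; $\bigwedge_{\alpha\in A}\bigvee_{F\in\mathcal H_\alpha}F\to\bigvee_{(F_\alpha)_{\alpha\in A}}\bigwedge_{\alpha\in A}F_\alpha$ for non-empty families $(\mathcal H_\alpha)_{\alpha\in A}$ of sets of formulas (disjunction over the Cartesian product). Rules: ($\wedge I$) from $\Gamma\Rightarrow H$ for all $H\in\mathcal H$ infer $\Gamma\Rightarrow\mathcal H^\wedge$; ($\wedge E$) from $\Gamma\Rightarrow\mathcal H^\wedge$ infer $\Gamma\Rightarrow H$, $H\in\mathcal H$; ($\vee I$) from $\Gamma\Rightarrow H$, $H\in\mathcal H$, infer $\Gamma\Rightarrow\mathcal H^\vee$; ($\vee E$) from $\Gamma\Rightarrow\mathcal H^\vee$ and $\Delta,H\Rightarrow F$ for all $H\in\mathcal H$ infer $\Gamma,\Delta\Rightarrow F$; ($\to I$) from $\Gamma,F\Rightarrow G$ infer $\Gamma\Rightarrow F\to G$; ($\to E$) from $\Gamma\Rightarrow F$ and $\Delta\Rightarrow F\to G$ infer $\Gamma,\Delta\Rightarrow G$; (W) from $\Gamma\Rightarrow F$ infer $\Gamma,\Delta\Rightarrow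 F$. $HT^\infty+gr(\mathit{Defs})$ adds each formula of $gr(\mathit{Defs})$ as an axiom; $F,G$ are equivalent in it if $F\leftrightarrow G$ is a theorem. *)

(* Defs.v *)
From Stdlib Require Import ZArith List Arith ClassicalEpsilon.
Import ListNotations.

(** * Infinitary propositional formulas

    A set of formulas is presented as a family indexed by a type, so that
    [Conj F] stands for the conjunction of the set [{F i : i in I}]. *)

Inductive form (A : Type) : Type :=
| Atom (a : A)
| Conj (I : Type) (F : I -> form A)
| Disj (I : Type) (F : I -> form A)
| Impl (F G : form A).

Arguments Atom {A} a.
Arguments Conj {A I} F.
Arguments Disj {A I} F.
Arguments Impl {A} F G.

Definition ConjOver {A T : Type} (P : T -> Prop) (F : T -> form A) : form A :=
  Conj (fun s : {x : T | P x} => F (proj1_sig s)).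

Definition DisjOver {A T : Type} (P : T -> Prop) (F : T -> form A) : form A :=
  Disj (fun s : {x : T | P x} => F (proj1_sig s)).

Definition Bot {A : Type} : form A := Disj (fun e : Empty_set => match e with end).
Definition Top {A : Type} : form A := Conj (fun e : Empty_set => match e with end).
Definition And {A : Type} (F G : form A) : form A :=
  Conj (fun b : bool => if b then F else G).
Definition Or {A : Type} (F G : form A) : form A :=
  Disj (fun b : bool => if b then F else G).
Definition Neg {A : Type} (F : form A) : form A := Impl F Bot.
Definition Iff {A : Type} (F G : form A) : form A := And (Impl F G) (Impl G F).

Definition truth {A : Type} (P : Prop) : form A :=
  if excluded_middle_informative P then Top else Bot.

Fixpoint sat {A : Type} (I : A -> Prop) (F : form A) : Prop :=
  match F with
  | Atom a => I a
  | Conj H => forall i, sat I (H i)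
  | Disj H => exists i, sat I (H i)
  | Impl G H => sat I G -> sat I H
  end.

Fixpoint reduct {A : Type} (I : A -> Prop) (F : form A) : form A :=
  if excluded_middle_informative (sat I F) then
    match F with
    | Atom a => Atom a
    | Conj H => Conj (fun i => reduct I (H i))
    | Disj H => Disj (fun i => reduct I (H i))
    | Impl G H => Impl (reduct I G) (reduct I H)
    end
  else Bot.

Definition stable_model {A : Type} (I : A -> Prop) (F : form A) : Prop :=
  sat I (reduct I F) /\
  forall J : A -> Prop,
    (forall a, J a -> I a) -> sat J (reduct I F) -> forall a, I a -> J a.

Definition strongly_equivalent {A : Type} (F G : form A) : Prop :=
  forall (H : form A) (I : A -> Prop),
    stable_model I (And F H) <-> stable_model I (And G H).

(** The deductive system HT-infinity extended by the formulas in [Ax] as axioms.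
    The finite set on the left of a sequent is presented as a list; [HT_weak]
    covers both weakening and the identification of lists with the same
    elements. *)

Inductive HT {A : Type} (Ax : form A -> Prop) : list (form A) -> form A -> Prop :=
| HT_ax F : Ax F -> HT Ax [] F
| HT_id F : HT Ax [F] F
| HT_hosoi F G : HT Ax [] (Or F (Or (Impl F G) (Neg G)))
| HT_distr (T : Type) (U : T -> Type) (H : forall a : T, U a -> form A) :
    inhabited T ->
    HT Ax [] (Impl (Conj (fun a : T => Disj (H a)))
                   (Disj (fun c : forall a : T, U a => Conj (fun a : T => H a (c a)))))
| HT_conjI Gamma (I : Type) (H : I -> form A) :
    (forall i, HT Ax Gamma (H i)) -> HT Ax Gamma (Conj H)
| HT_conjE Gamma (I : Type) (H : I -> form A) i :
    HT Ax Gamma (Conj H) -> HT Ax Gamma (H i)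
| HT_disjI Gamma (I : Type) (H : I -> form A) i :
    HT Ax Gamma (H i) -> HT Ax Gamma (Disj H)
| HT_disjE Gamma Delta (I : Type) (H : I -> form A) F :
    HT Ax Gamma (Disj H) -> (forall i, HT Ax (H i :: Delta) F) ->
    HT Ax (Gamma ++ Delta) F
| HT_implI Gamma F G : HT Ax (F :: Gamma) G -> HT Ax Gamma (Impl F G)
| HT_implE Gamma Delta F G :
    HT Ax Gamma F -> HT Ax Delta (Impl F G) -> HT Ax (Gamma ++ Delta) G
| HT_weak Gamma Delta F : HT Ax Gamma F -> incl Gamma Delta -> HT Ax Delta F.

Definition HT_equivalent {A : Type} (Ax : form A -> Prop) (F G : form A) : Prop :=
  HT Ax [] (Iff F G).

(** * Precomputed terms and terms *)

Definition symc := nat.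
Definition var := nat.

Inductive precomp : Set :=
| Num (n : Z)
| Sym (c : symc)
| Inf
| Sup.

Record precomp_order (le : precomp -> precomp -> Prop) : Prop := {
  po_antisym : forall r s, le r s -> le s r -> r = s;
  po_trans : forall r s t, le r s -> le s t -> le r t;
  po_total : forall r s, le r s \/ le s r;
  po_inf : forall r, le Inf r;
  po_sup : forall r, le r Sup;
  po_num : forall m n : Z, le (Num m) (Num n) <-> (m <= n)%Z;
  po_contiguous : forall (m n : Z) r,
    le (Num m) r -> le r (Num n) -> exists k : Z, r = Num k
}.

Inductive cmp : Set := CEq | CNe | CLt | CGt | CLe | CGe.

Definition cmp_holds (le : precomp -> precomp -> Prop) (op : cmp) (r s : precomp) : Prop :=
  match op with
  | CEq => r = s
  | CNe => r <> s
  | CLt => le r s /\ r <> s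
  | CGt => le s r /\ r <> s
  | CLe => le r s
  | CGe => le s r
  end.

Inductive arith : Set := OAdd | OSub | OMul.

Definition arith_eval (op : arith) (m n : Z) : Z :=
  match op with
  | OAdd => m + n
  | OSub => m - n
  | OMul => m * n
  end%Z.

Inductive binop : Set := Arith (op : arith) | Div | Mod | Interval.

Inductive term : Set :=
| Pre (r : precomp)
| Var (x : var)
| Bin (op : binop) (t1 t2 : term).

(** [Z.quot] rounds toward zero. *)
Definition binop_values (op : binop) (m n : Z) : list Z :=
  match op with
  | Arith o => [arith_eval o m n]
  | Div => if Z.eq_dec n 0 then [] else [Z.quot m n]
  | Mod => if Z.eq_dec n 0 then [] else [m - n * Z.quot m n]%Z
  | Interval => map (fun i => m + Z.of_nat i)%Z (seq 0 (Z.to_nat (n - m + 1)))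
  end.

(** The finite set of values of a ground term (meaningless if [t] has variables). *)
Fixpoint values (t : term) : list precomp :=
  match t with
  | Pre r => [r]
  | Var _ => []
  | Bin op t1 t2 =>
      flat_map (fun r1 => flat_map (fun r2 =>
        match r1, r2 with
        | Num m, Num n => map Num (binop_values op m n)
        | _, _ => []
        end) (values t2)) (values t1)
  end.

Definition tuple_values (ts : list term) (rs : list precomp) : Prop :=
  Forall2 (fun t r => In r (values t)) ts rs.

Fixpoint interval_free (t : term) : Prop :=
  match t with
  | Pre _ | Var _ => True
  | Bin op t1 t2 => op <> Interval /\ interval_free t1 /\ interval_free t2
  end.

Fixpoint vars_term (t : term) : list var :=
  match t with
  | Pre _ => []
  | Var x => [x]
  | Bin _ t1 t2 => vars_term t1 ++ vars_term t2
  end.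

(** * Rules and programs *)

Record atom : Set := MkAtom { apred : symc; aargs : list term }.

(** Literals and comparisons, the conjuncts of aggregate elements. *)
Inductive cond : Set :=
| Pos (a : atom)
| Not (a : atom)
| NotNot (a : atom)
| Cmp (op : cmp) (t1 t2 : term).

Inductive bound : Set := BGe | BLe.

(** [Count BGe X L t] and [Count BLe X L t] are [count{X:L} >= t] and
    [count{X:L} <= t]. *)
Inductive body_elem : Set :=
| Cond (c : cond)
| Count (b : bound) (X : list var) (L : list cond) (t : term).

Inductive head : Set :=
| Basic (a : atom)
| Choice (a : atom)
| Constraint.

Record rule : Set := MkRule { rhead : head; rbody : list body_elem }.

Definition vars_atom (a : atom) : list var := flat_map vars_term (aargs a).

Definition vars_cond (c : cond) : list var :=
  match c with
  | Pos a | Not a | NotNot a => vars_atom a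
  | Cmp _ t1 t2 => vars_term t1 ++ vars_term t2
  end.

Definition vars_conds (L : list cond) : list var := flat_map vars_cond L.

Definition vars_head (h : head) : list var :=
  match h with
  | Basic a | Choice a => vars_atom a
  | Constraint => []
  end.

Definition vars_rule (R : rule) : list var :=
  vars_head (rhead R) ++
  flat_map (fun B => match B with
                     | Cond c => vars_cond c
                     | Count _ X L t => X ++ vars_conds L ++ vars_term t
                     end) (rbody R).

(** The variables with an occurrence outside aggregate elements; the bound [t]
    of an aggregate atom is not part of its aggregate element. *)
Definition global_vars (R : rule) : list var :=
  vars_head (rhead R) ++
  flat_map (fun B => match B with
                     | Cond c => vars_cond c
                     | Count _ _ _ t => vars_term t
                     end) (rbody R).

Definition well_formed_rule (R : rule) : Prop :=
  forall b X L t, In (Count b X L t) (rbody R) ->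
    NoDup X /\ incl X (vars_conds L) /\ interval_free t.

Definition pure (R : rule) : Prop :=
  forall b X L t, In (Count b X L t) (rbody R) ->
    forall x, In x X -> ~ In x (global_vars R).

Definition MGC_program (Pi : list rule) : Prop :=
  forall R, In R Pi -> well_formed_rule R /\ pure R.

(** ** Substitution of precomputed terms for variables *)

Definition subst := var -> option precomp.

Fixpoint subst_term (s : subst) (t : term) : term :=
  match t with
  | Pre r => Pre r
  | Var x => match s x with Some r => Pre r | None => Var x end
  | Bin op t1 t2 => Bin op (subst_term s t1) (subst_term s t2)
  end.

Definition subst_atom (s : subst) (a : atom) : atom :=
  MkAtom (apred a) (map (subst_term s) (aargs a)).

Definition subst_cond (s : subst) (c : cond) : cond :=
  match c with
  | Pos a => Pos (subst_atom s a)
  | Not a => Not (subst_atom s a)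
  | NotNot a => NotNot (subst_atom s a)
  | Cmp op t1 t2 => Cmp op (subst_term s t1) (subst_term s t2)
  end.

Definition subst_body_elem (s : subst) (B : body_elem) : body_elem :=
  match B with
  | Cond c => Cond (subst_cond s c)
  | Count b X L t => Count b X (map (subst_cond s) L) (subst_term s t)
  end.

Definition subst_head (s : subst) (h : head) : head :=
  match h with
  | Basic a => Basic (subst_atom s a)
  | Choice a => Choice (subst_atom s a)
  | Constraint => Constraint
  end.

Definition subst_rule (s : subst) (R : rule) : rule :=
  MkRule (subst_head s (rhead R)) (map (subst_body_elem s) (rbody R)).

Definition is_instance (R R' : rule) : Prop :=
  exists f : var -> precomp,
    R' = subst_rule
           (fun x => if in_dec Nat.eq_dec x (global_vars R) then Some (f x) else None) R.

Fixpoint tuple_subst (xs : list var) (rs : list precomp) : subst :=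
  match xs, rs with
  | x :: xs', r :: rs' =>
      fun y => if Nat.eq_dec y x then Some r else tuple_subst xs' rs' y
  | _, _ => fun _ => None
  end.

(** * The translation tau *)

Definition patom : Set := (symc * list precomp)%type.

Definition vars_outside (L : list cond) (X : list var) : list var :=
  filter (fun x => if in_dec Nat.eq_dec x X then false else true)
         (nodup Nat.eq_dec (vars_conds L)).

Section Tau.

Context (le : precomp -> precomp -> Prop).

Definition tau_cond (c : cond) : form patom :=
  match c with
  | Pos a => DisjOver (tuple_values (aargs a)) (fun rs => Atom (apred a, rs))
  | Not a => DisjOver (tuple_values (aargs a)) (fun rs => Neg (Atom (apred a, rs)))
  | NotNot a =>
      DisjOver (tuple_values (aargs a)) (fun rs => Neg (Neg (Atom (apred a, rs))))
  | Cmp op t1 t2 =>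
      truth (exists r1 r2, In r1 (values t1) /\ In r2 (values t2) /\ cmp_holds le op r1 r2)
  end.

Definition tau_conds (L : list cond) : form patom :=
  ConjOver (fun c => In c L) tau_cond.

(** Finite sets of tuples of length [n], listed without repetitions. *)
Definition finite_tuple_set (n : nat) (Delta : list (list precomp)) : Prop :=
  NoDup Delta /\ forall xs, In xs Delta -> length xs = n.

Definition tau_all_satisfy (X : list var) (L : list cond) (Delta : list (list precomp))
  : form patom :=
  let W := vars_outside L X in
  ConjOver (fun xs => In xs Delta) (fun xs =>
    DisjOver (fun ws => length ws = length W) (fun ws =>
      tau_conds (map (subst_cond (tuple_subst (X ++ W) (xs ++ ws))) L))).

(** Since [t] is interval-free, [values t] is either [[]] or of the form [[c]]. *)
Definition tau_count (b : bound) (X : list var) (L : list cond) (t : term) : form patom :=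
  match values t with
  | [c] =>
      let card Delta := Num (Z.of_nat (length Delta)) in
      match b with
      | BGe =>
          DisjOver (fun Delta => finite_tuple_set (length X) Delta /\
                                 cmp_holds le CGe (card Delta) c)
                   (tau_all_satisfy X L)
      | BLe =>
          ConjOver (fun Delta => finite_tuple_set (length X) Delta /\
                                 cmp_holds le CGt (card Delta) c)
                   (fun Delta => Neg (tau_all_satisfy X L Delta))
      end
  | _ => Bot
  end.

Definition tau_body_elem (B : body_elem) : form patom :=
  match B with
  | Cond c => tau_cond c
  | Count b X L t => tau_count b X L t
  end.

Definition tau_body (Body : list body_elem) : form patom :=
  ConjOver (fun B => In B Body) tau_body_elem.

Definition tau_rule (R : rule) : form patom :=
  match rhead R with
  | Basic a =>
      Impl (tau_body (rbody R))
           (ConjOver (tuple_values (aargs a)) (fun rs => Atom (apred a, rs)))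
  | Choice a =>
      Impl (tau_body (rbody R))
           (ConjOver (tuple_values (aargs a)) (fun rs =>
              Or (Atom (apred a, rs)) (Neg (Atom (apred a, rs)))))
  | Constraint => Neg (tau_body (rbody R))
  end.

Definition tau (Pi : list rule) : form patom :=
  ConjOver (fun R' => exists R, In R Pi /\ is_instance R R') tau_rule.

End Tau.

(** * The two-sorted first-order language

    Rule variables are the general variables.  Terms of sort integer form a
    type of their own, which [GInt] includes into the general terms. *)

Inductive iterm : Set :=
| INum (n : Z)
| IVar (i : nat)
| IOp (op : arith) (a b : iterm).

Inductive gterm : Set :=
| GInt (a : iterm)
| GSym (c : symc)
| GInf
| GSup
| GVar (x : var).

Definition gpre (r : precomp) : gterm :=
  match r with
  | Num n => GInt (INum n)
  | Sym c => GSym c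
  | Inf => GInf
  | Sup => GSup
  end.

Inductive fovar : Set := Gen (x : var) | Int (i : nat).

(** First-order formulas with predicate constants from [P] and the six
    comparison symbols; the arity of a predicate constant is the number of
    arguments it is applied to. *)
Inductive fo (P : Type) : Type :=
| FBot
| FCmp (op : cmp) (t1 t2 : gterm)
| FPred (p : P) (ts : list gterm)
| FAnd (F G : fo P)
| FOr (F G : fo P)
| FImp (F G : fo P)
| FAll (v : fovar) (F : fo P)
| FEx (v : fovar) (F : fo P).

Arguments FBot {P}.
Arguments FCmp {P} op t1 t2.
Arguments FPred {P} p ts.
Arguments FAnd {P} F G.
Arguments FOr {P} F G.
Arguments FImp {P} F G.
Arguments FAll {P} v F.
Arguments FEx {P} v F.

Definition FNeg {P : Type} (F : fo P) : fo P := FImp F FBot.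
Definition FTop {P : Type} : fo P := FImp FBot FBot.
Definition FIff {P : Type} (F G : fo P) : fo P := FAnd (FImp F G) (FImp G F).

Fixpoint FConj {P : Type} (Fs : list (fo P)) : fo P :=
  match Fs with
  | [] => FTop
  | [F] => F
  | F :: Gs => FAnd F (FConj Gs)
  end.

Fixpoint FDisj {P : Type} (Fs : list (fo P)) : fo P :=
  match Fs with
  | [] => FBot
  | [F] => F
  | F :: Gs => FOr F (FDisj Gs)
  end.

Definition FAlls {P : Type} (vs : list fovar) (F : fo P) : fo P := fold_right FAll F vs.
Definition FExs {P : Type} (vs : list fovar) (F : fo P) : fo P := fold_right FEx F vs.

Definition fovar_eq_dec (v w : fovar) : {v = w} + {v <> w}.
Proof. decide equality; apply Nat.eq_dec. Defined.

Fixpoint iterm_vars (a : iterm) : list fovar :=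
  match a with
  | INum _ => []
  | IVar i => [Int i]
  | IOp _ a b => iterm_vars a ++ iterm_vars b
  end.

Definition gterm_vars (t : gterm) : list fovar :=
  match t with
  | GInt a => iterm_vars a
  | GVar x => [Gen x]
  | _ => []
  end.

Fixpoint free_vars {P : Type} (F : fo P) : list fovar :=
  match F with
  | FBot => []
  | FCmp _ t1 t2 => gterm_vars t1 ++ gterm_vars t2
  | FPred _ ts => flat_map gterm_vars ts
  | FAnd G H | FOr G H | FImp G H => free_vars G ++ free_vars H
  | FAll v G | FEx v G => remove fovar_eq_dec v (free_vars G)
  end.

Definition universal_closure {P : Type} (F : fo P) : fo P :=
  FAlls (nodup fovar_eq_dec (free_vars F)) F.

(** All variables of [F], free or bound. *)
Fixpoint all_vars {P : Type} (F : fo P) : list fovar :=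
  match F with
  | FBot => []
  | FCmp _ t1 t2 => gterm_vars t1 ++ gterm_vars t2
  | FPred _ ts => flat_map gterm_vars ts
  | FAnd G H | FOr G H | FImp G H => all_vars G ++ all_vars H
  | FAll v G | FEx v G => v :: all_vars G
  end.

Definition general_vars (vs : list fovar) : list var :=
  flat_map (fun v => match v with Gen x => [x] | Int _ => [] end) vs.

(** Every general variable from [fresh xs] on is different from all members of
    [xs]. *)
Definition fresh (xs : list var) : var := S (list_max xs).

Definition upd {T : Type} (f : nat -> T) (x : nat) (a : T) : nat -> T :=
  fun y => if Nat.eq_dec y x then a else f y.

(** Renaming of the free general variables.  It is used only when the new
    variables do not occur in the formula, so that no capture can happen. *)
Definition rename_gterm (s : var -> var) (t : gterm) : gterm :=
  match t with
  | GVar x => GVar (s x)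
  | _ => t
  end.

Fixpoint rename {P : Type} (s : var -> var) (F : fo P) : fo P :=
  match F with
  | FBot => FBot
  | FCmp op t1 t2 => FCmp op (rename_gterm s t1) (rename_gterm s t2)
  | FPred p ts => FPred p (map (rename_gterm s) ts)
  | FAnd G H => FAnd (rename s G) (rename s H)
  | FOr G H => FOr (rename s G) (rename s H)
  | FImp G H => FImp (rename s G) (rename s H)
  | FAll (Gen x) G => FAll (Gen x) (rename (upd s x x) G)
  | FEx (Gen x) G => FEx (Gen x) (rename (upd s x x) G)
  | FAll (Int i) G => FAll (Int i) (rename s G)
  | FEx (Int i) G => FEx (Int i) (rename s G)
  end.

Fixpoint tuple_rename (xs ys : list var) : var -> var :=
  match xs, ys with
  | x :: xs', y :: ys' => upd (tuple_rename xs' ys') x y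
  | _, _ => fun z => z
  end.

(** Predicate constants of the two signatures: [sigma0] consists of the [p/n],
    and [sigma1] adds the [Atleast] and [Atmost] constants. *)

Definition fo0 : Type := fo symc.

Inductive pred1 : Type :=
| Plain (p : symc)
| Atleast (X V : list var) (F : fo0)
| Atmost (X V : list var) (F : fo0).

Definition fo1 : Type := fo pred1.

Definition count_pred (b : bound) : list var -> list var -> fo0 -> pred1 :=
  match b with
  | BGe => Atleast
  | BLe => Atmost
  end.

(** The conditions under which [Atleast X V F] and [Atmost X V F] belong to the
    signature. *)
Definition count_pred_ok (X V : list var) (F : fo0) : Prop :=
  NoDup X /\ NoDup V /\ (forall x, In x X -> ~ In x V) /\
  incl (free_vars F) (map Gen (X ++ V)).

Fixpoint lift (F : fo0) : fo1 :=
  match F with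
  | FBot => FBot
  | FCmp op t1 t2 => FCmp op t1 t2
  | FPred p ts => FPred (Plain p) ts
  | FAnd G H => FAnd (lift G) (lift H)
  | FOr G H => FOr (lift G) (lift H)
  | FImp G H => FImp (lift G) (lift H)
  | FAll v G => FAll v (lift G)
  | FEx v G => FEx v (lift G)
  end.

(** * The formulas val_t(Z)

    The bound integer variables have indices [>= k]; [Z] is to contain integer
    variables with indices [< k] only. *)

Fixpoint val {P : Type} (k : nat) (t : term) (Z : gterm) : fo P :=
  let I := IVar k in
  let J := IVar (k + 1) in
  let zero := GInt (INum 0) in
  match t with
  | Pre r => FCmp CEq Z (gpre r)
  | Var x => FCmp CEq Z (GVar x)
  | Bin (Arith op) t1 t2 =>
      FExs [Int k; Int (k + 1)]
        (FConj [FCmp CEq Z (GInt (IOp op I J));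
                val (k + 4) t1 (GInt I);
                val (k + 4) t2 (GInt J)])
  | Bin Interval t1 t2 =>
      let K := IVar (k + 2) in
      FExs [Int k; Int (k + 1); Int (k + 2)]
        (FConj [val (k + 4) t1 (GInt I);
                val (k + 4) t2 (GInt J);
                FCmp CLe (GInt I) (GInt K);
                FCmp CLe (GInt K) (GInt J);
                FCmp CEq Z (GInt K)])
  | Bin op t1 t2 => (* [Div] or [Mod] *)
      let Q := IVar (k + 2) in
      let R := IVar (k + 3) in
      FExs [Int k; Int (k + 1); Int (k + 2); Int (k + 3)]
        (FConj [val (k + 4) t1 (GInt I);
                val (k + 4) t2 (GInt J);
                FCmp CNe (GInt J) zero;
                FCmp CEq (GInt I) (GInt (IOp OAdd (IOp OMul J Q) R));
                FCmp CGe (GInt (IOp OMul R I)) zero;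
                FCmp CLt (GInt (IOp OMul R R)) (GInt (IOp OMul J J));
                FCmp CEq Z (GInt (match op with Div => Q | _ => R end))])
  end.

Definition val_tuple {P : Type} (ts : list term) (Zs : list var) : fo P :=
  FConj (map (fun tz => val 0 (fst tz) (GVar (snd tz))) (combine ts Zs)).

(** * The translations tau^B and tau^* *)

Definition tauB_atom (a : atom) (F : list gterm -> fo0) : fo0 :=
  let Zs := seq (fresh (vars_atom a)) (length (aargs a)) in
  FExs (map Gen Zs) (FAnd (val_tuple (aargs a) Zs) (F (map GVar Zs))).

Definition tauB (c : cond) : fo0 :=
  match c with
  | Pos a => tauB_atom a (FPred (apred a))
  | Not a => tauB_atom a (fun ts => FNeg (FPred (apred a) ts))
  | NotNot a => tauB_atom a (fun ts => FNeg (FNeg (FPred (apred a) ts)))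
  | Cmp op t1 t2 =>
      let Z1 := fresh (vars_term t1 ++ vars_term t2) in
      let Z2 := S Z1 in
      FExs [Gen Z1; Gen Z2]
        (FConj [val 0 t1 (GVar Z1); val 0 t2 (GVar Z2); FCmp op (GVar Z1) (GVar Z2)])
  end.

Definition tauB_conds (L : list cond) : fo0 := FConj (map tauB L).

(** [globals] are the global variables of the rule containing the conjunct. *)
Definition tau_star_body_elem (globals : list var) (B : body_elem) : fo1 :=
  match B with
  | Cond c => lift (tauB c)
  | Count b X L t =>
      let is_global x := if in_dec Nat.eq_dec x globals then true else false in
      let V := filter is_global (nodup Nat.eq_dec (vars_conds L)) in
      let W := filter (fun x => negb (is_global x)) (vars_outside L X) in
      let C := fresh (vars_term t ++ V) in
      FEx (Gen C)
        (FAnd (val 0 t (GVar C))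
              (FPred (count_pred b X V (FExs (map Gen W) (tauB_conds L)))
                     (map GVar (V ++ [C]))))
  end.

Definition tau_star_rule (R : rule) : fo1 :=
  let Bs := map (tau_star_body_elem (global_vars R)) (rbody R) in
  let Zs a := seq (fresh (vars_rule R)) (length (aargs a)) in
  let body a := FConj (Bs ++ [val_tuple (aargs a) (Zs a)]) in
  let pZ a := FPred (Plain (apred a)) (map GVar (Zs a)) in
  universal_closure
    match rhead R with
    | Basic a => FImp (body a) (pZ a)
    | Choice a => FImp (body a) (FOr (pZ a) (FNeg (pZ a)))
    | Constraint => FNeg (FConj Bs)
    end.

Definition tau_star (Pi : list rule) : fo1 := FConj (map tau_star_rule Pi).

(** * Counting formulas and Defs *)

(** [n] disjoint tuples of fresh variables, each of the length of [X]. *)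
Definition fresh_tuples (n : nat) (X : list var) (F : fo0) : list (list var) :=
  let base := fresh (X ++ general_vars (all_vars F)) in
  map (fun i => seq (base + i * length X) (length X)) (seq 0 n).

Definition tuple_eq (Xi Xj : list var) : fo0 :=
  FConj (map (fun xy => FCmp CEq (GVar (fst xy)) (GVar (snd xy))) (combine Xi Xj)).

Fixpoint pairs {T : Type} (l : list T) : list (T * T) :=
  match l with
  | [] => []
  | x :: l' => map (pair x) l' ++ pairs l'
  end.

Definition copies (Xs : list (list var)) (X : list var) (F : fo0) : list fo0 :=
  map (fun Xi => rename (tuple_rename X Xi) F) Xs.

Section Counting.

Context (le : precomp -> precomp -> Prop).

(** By contiguity of the numerals, a precomputed term that is not a positive
    numeral and is not [<= 0] exceeds all numerals; similarly for
    [exists_atmost]. *)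
Definition exists_atleast (r : precomp) (X : list var) (F : fo0) : fo0 :=
  match r with
  | Num (Zpos p) =>
      let Xs := fresh_tuples (Pos.to_nat p) X F in
      FExs (map Gen (concat Xs))
        (FConj (copies Xs X F ++
                map (fun XY => FNeg (tuple_eq (fst XY) (snd XY))) (pairs Xs)))
  | _ =>
      if excluded_middle_informative (cmp_holds le CLe r (Num 0)) then FTop else FBot
  end.

Definition exists_atmost (r : precomp) (X : list var) (F : fo0) : fo0 :=
  let bounded n :=
    let Xs := fresh_tuples (S n) X F in
    FAlls (map Gen (concat Xs))
      (FImp (FConj (copies Xs X F))
            (FDisj (map (fun XY => tuple_eq (fst XY) (snd XY)) (pairs Xs)))) in
  match r with
  | Num Z0 => bounded 0
  | Num (Zpos p) => bounded (Pos.to_nat p)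
  | _ =>
      if excluded_middle_informative (cmp_holds le CLt r (Num 0)) then FBot else FTop
  end.

Inductive Defs : fo1 -> Prop :=
| Defs_atleast X V F r : count_pred_ok X V F ->
    Defs (FAlls (map Gen V)
            (FIff (FPred (Atleast X V F) (map GVar V ++ [gpre r]))
                  (lift (exists_atleast r X F))))
| Defs_atmost X V F r : count_pred_ok X V F ->
    Defs (FAlls (map Gen V)
            (FIff (FPred (Atmost X V F) (map GVar V ++ [gpre r]))
                  (lift (exists_atmost r X F)))).

(** * Grounding

    Instead of substituting values for the variables bound by quantifiers, we
    record them in assignments [g] (general variables) and [h] (integer
    variables). *)

Fixpoint iterm_eval (h : nat -> Z) (a : iterm) : Z :=
  match a with
  | INum n => n
  | IVar i => h i
  | IOp op a b => arith_eval op (iterm_eval h a) (iterm_eval h b)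
  end.

Definition gterm_eval (g : var -> precomp) (h : nat -> Z) (t : gterm) : precomp :=
  match t with
  | GInt a => Num (iterm_eval h a)
  | GSym c => Sym c
  | GInf => Inf
  | GSup => Sup
  | GVar x => g x
  end.

Fixpoint ground {P : Type} (g : var -> precomp) (h : nat -> Z) (F : fo P)
  : form (P * list precomp) :=
  match F with
  | FBot => Bot
  | FCmp op t1 t2 => truth (cmp_holds le op (gterm_eval g h t1) (gterm_eval g h t2))
  | FPred p ts => Atom (p, map (gterm_eval g h) ts)
  | FAnd G H => And (ground g h G) (ground g h H)
  | FOr G H => Or (ground g h G) (ground g h H)
  | FImp G H => Impl (ground g h G) (ground g h H)
  | FAll (Gen x) G => Conj (fun r : precomp => ground (upd g x r) h G)
  | FAll (Int i) G => Conj (fun n : Z => ground g (upd h i n) G)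
  | FEx (Gen x) G => Disj (fun r : precomp => ground (upd g x r) h G)
  | FEx (Int i) G => Disj (fun n : Z => ground g (upd h i n) G)
  end.

(** For a sentence the choice of the initial assignments is irrelevant. *)
Definition gr (F : fo1) : form (pred1 * list precomp) :=
  ground (fun _ => Inf) (fun _ => 0%Z) F.

Definition gr_Defs (G : form (pred1 * list precomp)) : Prop :=
  exists F, Defs F /\ G = gr F.

End Counting.

(* Main.v *)
Require Import Defs.
From Stdlib Require Import List.
From Stdlib Require Import ZArith Zquot Lia Arith ClassicalEpsilon Classical Morphisms_Prop.
From Stdlib Require Import FunctionalExtensionality PropExtensionality.
Import ListNotations.

(* Both sides are statements about here-and-there (HT) interpretations.  Strong
   equivalence means having the same HT-models, and provability in HT-infinity
   with additional axioms is truth in all HT-models of the axioms.  In an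
   HT-model of [Defs] the atoms [Atleast] and [Atmost] mean what the counting
   formulas say, so that [gr (tau_star Pi)] is true there if and only if
   [tau Pi] is true in the restriction to the precomputed atoms; and every
   HT-interpretation of the precomputed atoms is such a restriction. *)

(** * Here-and-there semantics *)

(** Formulas may be infinite and there may be any number of atoms, so completeness is not obtained
    by extending a theory one formula at a time. The distributivity axiom settles all atoms and all
    pairs of atoms in a single choice instead. No available disjunct says that an atom is true there
    without being derivable, so a choice fixes an HT-interpretation only up to identifying its two
    worlds. Hence derivability is extracted from truth in two interpretations, the chosen one and
    its total collapse.

    For aggregates the two sides count differently: [tau] ranges over all finite sets whose size
    reaches or exceeds the bound, a counting formula over tuples of one exact number. Cutting a set
    down to an initial segment reconciles them. *)

(* The worlds "here" and "there" are [false] and [true]. *)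
Definition accessible (w w' : bool) : Prop := w = true -> w' = true.

Fixpoint forces {A : Type} (v : bool -> A -> Prop) (w : bool) (F : form A) : Prop :=
  match F with
  | Atom a => v w a
  | Conj H => forall i, forces v w (H i)
  | Disj H => exists i, forces v w (H i)
  | Impl G H => forall w', accessible w w' -> forces v w' G -> forces v w' H
  end.

Definition monotone {A : Type} (v : bool -> A -> Prop) : Prop :=
  forall a, v false a -> v true a.

Lemma accessible_refl w : accessible w w.
Proof. exact (fun H => H). Qed.

Lemma accessible_true w : accessible w true.
Proof. exact (fun _ => eq_refl). Qed.

Lemma accessible_trans w1 w2 w3 :
  accessible w1 w2 -> accessible w2 w3 -> accessible w1 w3.
Proof. unfold accessible; auto. Qed.

#[local] Hint Resolve accessible_refl accessible_true : core.

Section Semantics.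

Context {A : Type}.
Implicit Types (v : bool -> A -> Prop) (F G : form A).

(** Persistence: only atoms need monotonicity, as an implication already quantifies over all
    accessible worlds. *)
Lemma forces_accessible v F : monotone v ->
  forall w w', accessible w w' -> forces v w F -> forces v w' F.
Proof.
  intros Hv; induction F as [a|I H IH|I H IH|G IHG H IHH]; simpl; intros w w' Hw.
  - destruct w, w'; auto; discriminate (Hw eq_refl).
  - intros HF i; exact (IH i w w' Hw (HF i)).
  - intros [i HF]; exists i; exact (IH i w w' Hw HF).
  - intros HF w'' Hw'; apply HF; exact (accessible_trans _ _ _ Hw Hw').
Qed.

Lemma forces_true v F : forces v true F <-> sat (v true) F.
Proof.
  induction F as [a|I H IH|I H IH|G IHG H IHH]; simpl.
  - reflexivity.
  - split; intros HF i; apply IH, HF.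
  - split; intros [i HF]; exists i; apply IH, HF.
  - rewrite <- IHG, <- IHH; split; intros HF.
    + exact (HF true (accessible_refl true)).
    + intros w' Hw; rewrite (Hw eq_refl); exact HF.
Qed.

Lemma forces_true_eq v v' F : v true = v' true -> forces v true F -> forces v' true F.
Proof. intros E; rewrite !forces_true, E; auto. Qed.

Lemma forces_total v F : monotone v -> (forall a, v true a -> v false a) ->
  forces v true F -> forces v false F.
Proof.
  (* An implication needs the converse direction for its premise, so the induction proves an
     equivalence. *)
  intros Hv Ht; assert (E : forces v true F <-> forces v false F); [|apply E].
  induction F as [a|I H IH|I H IH|G IHG H IHH]; simpl.
  - split; auto.
  - split; intros HF i; apply IH, HF.
  - split; intros [i HF]; exists i; apply IH, HF.
  - split; intros HF w' Hw HG.
    + destruct w'; [exact (HF true (accessible_refl _) HG)|].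
      apply IHH, HF; [auto|]; apply IHG, HG.
    + rewrite (Hw eq_refl) in *; exact (HF true (accessible_true _) HG).
Qed.

Lemma forces_Bot v w : forces v w Bot <-> False.
Proof. split; [intros [[] _]|intros []]. Qed.

Lemma forces_Top v w : forces v w Top <-> True.
Proof. split; [auto|intros _ []]. Qed.

Lemma forces_And v w F G : forces v w (And F G) <-> forces v w F /\ forces v w G.
Proof.
  split.
  - intros H; exact (conj (H true) (H false)).
  - intros [H1 H2] []; assumption.
Qed.

Lemma forces_Or v w F G : forces v w (Or F G) <-> forces v w F \/ forces v w G.
Proof.
  split.
  - intros [[] H]; auto.
  - intros [H|H]; [exists true|exists false]; exact H.
Qed.

Lemma forces_Neg v w F :
  forces v w (Neg F) <-> forall w', accessible w w' -> ~ forces v w' F.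
Proof.
  split.
  - intros H w' Hw HF; exact (proj1 (forces_Bot v w') (H w' Hw HF)).
  - intros H w' Hw HF; destruct (H w' Hw HF).
Qed.

Lemma forces_truth v w P : forces v w (truth P) <-> P.
Proof.
  unfold truth; destruct excluded_middle_informative as [H|H].
  - rewrite forces_Top; tauto.
  - rewrite forces_Bot; tauto.
Qed.

Lemma forces_Iff v w F G :
  forces v w (Iff F G) <->
  forall w', accessible w w' -> (forces v w' F <-> forces v w' G).
Proof.
  unfold Iff; rewrite forces_And; simpl; split.
  - intros [H1 H2] w' Hw; split; auto.
  - intros H; split; intros w' Hw; apply H, Hw.
Qed.

Lemma forces_ConjOver {T : Type} v w (P : T -> Prop) (F : T -> form A) :
  forces v w (ConjOver P F) <-> forall x, P x -> forces v w (F x).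
Proof.
  split.
  - intros H x Hx; exact (H (exist _ x Hx)).
  - intros H [x Hx]; exact (H x Hx).
Qed.

Lemma forces_DisjOver {T : Type} v w (P : T -> Prop) (F : T -> form A) :
  forces v w (DisjOver P F) <-> exists x, P x /\ forces v w (F x).
Proof.
  split.
  - intros [[x Hx] H]; exists x; auto.
  - intros (x & Hx & H); exists (exist _ x Hx); exact H.
Qed.

Lemma forces_Impl_iff v w F F' G G' :
  (forall w', forces v w' F <-> forces v w' F') ->
  (forall w', forces v w' G <-> forces v w' G') ->
  forces v w (Impl F G) <-> forces v w (Impl F' G').
Proof.
  intros HF HG; split; intros H w' Hw; rewrite HF || rewrite <- HF; intro; apply HG, H; auto.
Qed.

(** * Strong equivalence *)

Definition ht_interp (J I : A -> Prop) (w : bool) : A -> Prop := if w then I else J.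

(** The reduct replaces by [Bot] exactly the subformulas that fail there, and by persistence these
    are not forced here either. An implication that survives is true there, which is the other half
    of its being forced here. *)
Lemma sat_reduct (J I : A -> Prop) F : (forall a, J a -> I a) ->
  sat J (reduct I F) <-> forces (ht_interp J I) false F.
Proof.
  intros HJ.
  assert (Hm : monotone (ht_interp J I)) by exact HJ.
  induction F as [a|K H IH|K H IH|G IHG H IHH]; cbn [reduct];
    destruct excluded_middle_informative as [Hs|Hs];
    try (split; [intros [[] _]|]; intros HF; destruct Hs;
         apply (forces_true (ht_interp J I)), (forces_accessible _ _ Hm false); auto; fail).
  - reflexivity.
  - split; intros HF i; apply IH, HF.
  - split; intros [i HF]; exists i; apply IH, HF.
  - simpl; rewrite IHG, IHH; split.
    + intros HF [] _; [|exact HF].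
      rewrite !forces_true; exact Hs.
    + intros HF; exact (HF false (accessible_refl _)).
Qed.

(** Stable models are the equilibrium models of here-and-there logic: total models that stay models
    for no smaller here world. *)
Lemma stable_model_ht (I : A -> Prop) F :
  stable_model I F <->
  forces (ht_interp I I) false F /\
  forall J : A -> Prop, (forall a, J a -> I a) ->
    forces (ht_interp J I) false F -> forall a, I a -> J a.
Proof.
  unfold stable_model; rewrite sat_reduct by auto.
  split; intros [H1 H2]; split; auto; intros J HJ HF; apply (H2 J HJ);
    apply (sat_reduct J I F HJ), HF.
Qed.

Definition ht_equivalent F G : Prop :=
  forall v, monotone v -> (forces v false F <-> forces v false G).

(** With all atoms of [I] added as facts no proper subset of [I] can compete, so every total model
    becomes stable and is visible to strong equivalence. *)
Lemma strongly_equivalent_total F G (I : A -> Prop) : strongly_equivalent F G ->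
  forces (ht_interp I I) false F -> forces (ht_interp I I) false G.
Proof.
  intros HFG HF.
  assert (HG : stable_model I (And G (ConjOver I Atom))).
  { apply HFG, stable_model_ht; split.
    - apply forces_And; split; [exact HF|]; apply forces_ConjOver; simpl; auto.
    - intros J HJ HJF a Ha; apply forces_And in HJF; destruct HJF as [_ HJF].
      rewrite forces_ConjOver in HJF; exact (HJF a Ha). }
  apply stable_model_ht in HG; destruct HG as [HG _].
  apply forces_And in HG; exact (proj1 HG).
Qed.

(** If [G] failed here, a context [H] admitting only the here worlds [J] and [I] would make [I]
    stable for [G] with [H]. Since [(J, I)] is a model of [F] with [H], stability transferred to [F]
    forces [J = I], where [G] holds by the total case. *)
Lemma strongly_equivalent_forces F G v : strongly_equivalent F G -> monotone v ->
  forces v false F -> forces v false G.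
Proof.
  intros HFG Hv HF; apply NNPP; intros HnG.
  set (J := v false); set (I := v true).
  assert (Ev : forall K, forces v false K <-> forces (ht_interp J I) false K).
  { intros K; replace (ht_interp J I) with v; [reflexivity|].
    apply functional_extensionality; intros []; reflexivity. }
  assert (HI : forces (ht_interp I I) false G).
  { apply (strongly_equivalent_total F G I HFG).
    apply forces_total; [exact (fun _ H => H)..|].
    apply (forces_true_eq v); [reflexivity|]; apply (forces_accessible v F Hv false); auto. }
  (* The HT-models of [H] with "there" world [I] are [(J, I)] and [(I, I)]. *)
  set (H := And (ConjOver J Atom)
              (ConjOver (fun pq : A * A => (I (fst pq) /\ ~ J (fst pq)) /\ I (snd pq))
                        (fun pq => Impl (Atom (fst pq)) (Atom (snd pq))))).
  assert (HH : forall K : A -> Prop, (forall a, K a -> I a) -> (forall a, J a -> K a) ->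
    ((forall a, K a -> J a) \/ (forall a, I a -> K a)) -> forces (ht_interp K I) false H).
  { intros K HKI HJK HK; apply forces_And; split; apply forces_ConjOver; [exact HJK|].
    intros [p q] [[Hp HnJp] Hq]; simpl in *; intros [] _ HKp; simpl in *; [exact Hq|].
    destruct HK as [HK|HK]; [destruct HnJp|]; auto. }
  assert (HGH : stable_model I (And G H)).
  { apply stable_model_ht; split.
    - apply forces_And; split; [exact HI|]; apply HH; auto.
    - intros K HKI HK a Ha; apply forces_And in HK; destruct HK as [HKG HK].
      apply forces_And in HK; destruct HK as [HJK HK].
      pose proof (proj1 (forces_ConjOver _ _ _ _) HJK) as HJK'; simpl in HJK'.
      pose proof (proj1 (forces_ConjOver _ _ _ _) HK) as HK'.
      (* Either [K] exceeds [J], and the implications in [H] spread one additional atom to all of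
         [I], or [K] equals [J], where [G] fails. *)
      destruct (classic (exists p, K p /\ ~ J p)) as [(p & HKp & HnJp)|HKJ].
      + apply (HK' (p, a) (conj (conj (HKI p HKp) HnJp) Ha) false); simpl; auto.
      + destruct HnG; apply Ev.
        replace J with K; [exact HKG|].
        apply functional_extensionality; intros b; apply propositional_extensionality.
        split; auto; intros HKb; apply NNPP; intros HnJb; apply HKJ; eauto. }
  apply HFG, stable_model_ht in HGH; destruct HGH as [_ HFmin].
  assert (HIJ : forall a, I a -> J a).
  { apply HFmin; [exact Hv|]; apply forces_And; split; [apply Ev, HF|].
    apply HH; auto. }
  apply HnG, forces_total; auto.
  apply (forces_true_eq (ht_interp I I)); [reflexivity|].
  apply (forces_accessible (ht_interp I I) G (fun _ H => H) false); auto.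
Qed.

Lemma strongly_equivalent_iff_ht F G : strongly_equivalent F G <-> ht_equivalent F G.
Proof.
  split.
  - intros H v Hv; split; apply strongly_equivalent_forces; auto.
    intros K I; symmetry; apply H.
  - intros H K I; rewrite !stable_model_ht.
    assert (E : forall J : A -> Prop, (forall a, J a -> I a) ->
      forces (ht_interp J I) false (And F K) <-> forces (ht_interp J I) false (And G K)).
    { intros J HJ; rewrite !forces_And, (H (ht_interp J I) HJ); reflexivity. }
    split; intros [H1 H2]; (split; [apply E; auto|]);
      intros J HJ HF; apply (H2 J HJ), E; auto.
Qed.

(** * Soundness and completeness of the deductive system *)

Lemma HT_sound (Ax : form A -> Prop) Gamma F v : HT Ax Gamma F -> monotone v ->
  (forall G, Ax G -> forces v false G) ->
  forall w, (forall G, In G Gamma -> forces v w G) -> forces v w F.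
Proof.
  intros HF Hv Hax; induction HF as
    [F HF|F|F G|T U H [t0]|Gamma I H _ IH|Gamma I H i _ IH|Gamma I H i _ IH
    |Gamma Delta I H F _ IHH _ IHF|Gamma F G _ IH|Gamma Delta F G _ IHF _ IHG
    |Gamma Delta F _ IH Hincl]; intros w Hw.
  - apply (forces_accessible v F Hv false); [discriminate|auto].
  - apply Hw; left; reflexivity.
  - rewrite forces_Or, forces_Or, forces_Neg; simpl.
    (* If [F] fails at [w], the value of [G] there decides: if true, [F -> G] holds, as only [w] and
       there can be accessible; if false, persistence refutes [G] everywhere. *)
    destruct (classic (forces v w F)) as [HF|HF]; [auto|right].
    destruct (classic (forces v true G)) as [HG|HG].
    + left; intros w' Hw' HF'; destruct w'; [exact HG|].
      destruct w; [discriminate (Hw' eq_refl)|contradiction].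
    + right; intros w' Hw' HG'; apply HG, (forces_accessible v G Hv w'); auto.
  - intros w' _ HF.
    (* Semantically, distributivity is the axiom of choice. *)
    exists (fun t => proj1_sig (constructive_indefinite_description _ (HF t))).
    intros t; exact (proj2_sig (constructive_indefinite_description _ (HF t))).
  - intros i; apply IH, Hw.
  - exact (IH w Hw i).
  - exists i; apply IH, Hw.
  - destruct (IHH w) as [i Hi].
    + intros G HG; apply Hw, in_or_app; auto.
    + apply (IHF i w); intros G [<-|HG]; [exact Hi|]; apply Hw, in_or_app; auto.
  - intros w' Hw' HF'; apply IH; intros K [<-|HK]; [exact HF'|].
    apply (forces_accessible v K Hv w w' Hw'), Hw, HK.
  - apply (IHG w (fun K HK => Hw K (in_or_app _ _ _ (or_intror HK))) w (accessible_refl w)).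
    apply IHF; intros K HK; apply Hw, in_or_app; auto.
  - apply IH; intros G HG; apply Hw, Hincl, HG.
Qed.

(** * Derived rules of HT-infinity *)

Section Deduction.

Context (Ax : form A -> Prop).

Notation "Gamma |- F" := (HT Ax Gamma F) (at level 70).

Lemma HT_hyp Gamma F : In F Gamma -> Gamma |- F.
Proof.
  intros H; apply (HT_weak Ax [F]); [apply HT_id|].
  intros G [<-|[]]; exact H.
Qed.

Lemma HT_closed Gamma F : [] |- F -> Gamma |- F.
Proof. intros H; apply (HT_weak Ax []); [exact H|intros G []]. Qed.

Lemma HT_cons Gamma F G : Gamma |- F -> G :: Gamma |- F.
Proof. intros H; apply (HT_weak Ax Gamma); [exact H|intros K HK; right; exact HK]. Qed.

Lemma HT_mp Gamma F G : Gamma |- Impl F G -> Gamma |- F -> Gamma |- G.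
Proof.
  intros HI HF; apply (HT_weak Ax (Gamma ++ Gamma)); [exact (HT_implE Ax _ _ _ _ HF HI)|].
  intros K HK; apply in_app_or in HK; tauto.
Qed.

Lemma HT_cases Gamma (I : Type) (H : I -> form A) F :
  Gamma |- Disj H -> (forall i, H i :: Gamma |- F) -> Gamma |- F.
Proof.
  intros HD HF; apply (HT_weak Ax (Gamma ++ Gamma)); [exact (HT_disjE Ax _ _ _ _ _ HD HF)|].
  intros K HK; apply in_app_or in HK; tauto.
Qed.

Lemma HT_bot Gamma F : Gamma |- Bot -> Gamma |- F.
Proof. intros H; apply (HT_cases _ _ _ _ H); intros []. Qed.

Lemma HT_contra Gamma F G : Gamma |- F -> Gamma |- Neg F -> Gamma |- G.
Proof. intros HF HN; apply HT_bot, (HT_mp _ F); assumption. Qed.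

Lemma HT_impl_trans Gamma F G H : Gamma |- Impl F G -> Gamma |- Impl G H -> Gamma |- Impl F H.
Proof.
  intros H1 H2; apply HT_implI, (HT_mp _ G); [apply HT_cons, H2|].
  apply (HT_mp _ F); [apply HT_cons, H1|apply HT_hyp; left; reflexivity].
Qed.

Lemma HT_const Gamma F G : Gamma |- G -> Gamma |- Impl F G.
Proof. intros H; apply HT_implI, HT_cons, H. Qed.

Lemma HT_neg_impl Gamma F G : Gamma |- Neg F -> Gamma |- Impl F G.
Proof.
  intros H; apply HT_implI, (HT_contra _ F); [apply HT_hyp; left; reflexivity|apply HT_cons, H].
Qed.

Lemma HT_contrapose Gamma F G : Gamma |- Impl F G -> Gamma |- Neg G -> Gamma |- Neg F.
Proof. apply HT_impl_trans. Qed.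

(** Hosoi's axiom for [Neg F] and [F] has the disjuncts [Neg F], [Impl (Neg F) F] and [Neg F]; the
    middle one refutes [Neg F]. *)
Lemma HT_weak_em Gamma F : Gamma |- Or (Neg F) (Neg (Neg F)).
Proof.
  apply (HT_cases _ _ _ _ (HT_closed _ _ (HT_hosoi Ax (Neg F) F))); intros [].
  - apply (HT_disjI _ _ bool _ true), HT_hyp; left; reflexivity.
  - eapply HT_cases; [apply HT_hyp; left; reflexivity|]; intros [].
    + apply (HT_disjI _ _ bool _ false), HT_implI.
      apply (HT_contra _ F); [|apply HT_hyp; left; reflexivity].
      apply (HT_mp _ (Neg F)); apply HT_hyp; simpl; auto.
    + apply (HT_disjI _ _ bool _ true), HT_hyp; left; reflexivity.
Qed.

(** * Deriving the truth value of every formula from a description of an interpretation *)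

Section Decide.

(* [Gamma] describes the HT-interpretation [v] up to a possible collapse of
   "here" to "there": all undecided atoms are equivalent to each other. *)
Context (v : bool -> A -> Prop) (Gamma : list (form A)).
Hypothesis Hv : monotone v.

Definition undecided a : Prop := v true a /\ ~ v false a.

Hypothesis Hhere : forall a, v false a -> Gamma |- Atom a.
Hypothesis Hnot : forall a, ~ v true a -> Gamma |- Neg (Atom a).
Hypothesis Hthere : forall a, v true a -> Gamma |- Neg (Neg (Atom a)).
Hypothesis Hundec : forall a b, undecided a -> undecided b -> Gamma |- Impl (Atom a) (Atom b).

(** The clauses are the three truth values of here-and-there logic. For the intermediate one [Gamma]
    may neither prove nor refute [F], so the value is recorded as provable equivalence with every
    undecided atom. *)
Definition decided F : Prop :=
  (forces v false F -> Gamma |- F) /\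
  (~ forces v true F -> Gamma |- Neg F) /\
  (forces v true F -> ~ forces v false F ->
   forall a, undecided a -> Gamma |- Impl F (Atom a) /\ Gamma |- Impl (Atom a) F).

(** Without undecided atoms [v] would be total, and its two worlds would agree on [F]. *)
Lemma undecided_exists F : forces v true F -> ~ forces v false F -> exists a, undecided a.
Proof.
  intros Ht Hh; apply NNPP; intros Hn; apply Hh, forces_total; auto.
  intros a Ha; apply NNPP; intros Ha'; apply Hn; exists a; split; assumption.
Qed.

Lemma decided_neg_neg F : decided F -> forces v true F -> Gamma |- Neg (Neg F).
Proof.
  intros (H1 & H2 & H3) HF; destruct (classic (forces v false F)) as [Hh|Hh].
  - apply HT_implI, (HT_contra _ F); [apply HT_cons, H1, Hh|apply HT_hyp; left; reflexivity].
  - destruct (undecided_exists F HF Hh) as [a Ha]; destruct (H3 HF Hh a Ha) as [_ HaF].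
    apply HT_implI, (HT_contra _ (Neg (Atom a))); [|apply HT_cons, Hthere, Ha].
    apply (HT_contrapose _ _ F); [apply HT_cons, HaF|apply HT_hyp; left; reflexivity].
Qed.

(** The induction follows the three-valued truth tables; two formulas of intermediate value are
    linked through a common undecided atom. *)
Lemma decided_all F : decided F.
Proof.
  induction F as [a|I H IH|I H IH|G IHG H IHH].
  - split; [exact (Hhere a)|split; [exact (Hnot a)|]].
    intros Ht Hh b Hb; split; apply Hundec; auto; split; assumption.
  - split; [|split]; simpl.
    + intros HF; apply HT_conjI; intros i; apply IH, HF.
    + intros HF; apply not_all_ex_not in HF; destruct HF as [i Hi].
      apply (HT_contrapose _ _ (H i)); [|apply IH, Hi].
      apply HT_implI, HT_conjE, HT_hyp; left; reflexivity.
    + intros Ht Hh a Ha; split.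
      * apply not_all_ex_not in Hh; destruct Hh as [i Hi].
        apply (HT_impl_trans _ _ (H i)); [|apply IH; auto].
        apply HT_implI, HT_conjE, HT_hyp; left; reflexivity.
      * apply HT_implI, HT_conjI; intros i.
        apply (HT_mp _ (Atom a)); [apply HT_cons|apply HT_hyp; left; reflexivity].
        destruct (classic (forces v false (H i))) as [Hi|Hi].
        -- apply HT_const, IH, Hi.
        -- apply IH; auto.
  - split; [|split]; simpl.
    + intros [i HF]; apply (HT_disjI _ _ _ _ i), IH, HF.
    + intros HF; apply HT_implI.
      eapply HT_cases; [apply HT_hyp; left; reflexivity|]; intros i.
      apply (HT_contra _ (H i)); [apply HT_hyp; left; reflexivity|].
      apply HT_cons, HT_cons, IH; eauto.
    + intros [i Ht] Hh a Ha; split.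
      * apply HT_implI; eapply HT_cases; [apply HT_hyp; left; reflexivity|]; intros j.
        apply (HT_mp _ (H j)); [apply HT_cons, HT_cons|apply HT_hyp; left; reflexivity].
        destruct (classic (forces v true (H j))) as [Hj|Hj].
        -- apply IH; eauto.
        -- apply HT_neg_impl, IH, Hj.
      * apply (HT_impl_trans _ _ (H i)); [apply IH; eauto|].
        apply HT_implI, (HT_disjI _ _ _ _ i), HT_hyp; left; reflexivity.
  - assert (HGf : forces v false G -> forces v true G)
      by (apply forces_accessible; auto).
    split; [|split].
    + intros HF.
      destruct (classic (forces v false H)) as [Hh|Hh]; [apply HT_const, IHH, Hh|].
      destruct (classic (forces v true G)) as [Gt|Gt]; [|apply HT_neg_impl, IHG, Gt].
      assert (Gh : ~ forces v false G) by (intros Gh; apply Hh, (HF false); auto).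
      assert (Ht : forces v true H) by (apply (HF true); auto).
      destruct (undecided_exists G Gt Gh) as [a Ha].
      apply (HT_impl_trans _ _ (Atom a)); [apply IHG|apply IHH]; auto.
    + intros HF.
      assert (Gt : forces v true G).
      { apply NNPP; intros Gt; apply HF; intros w' Hw HG.
        rewrite (Hw eq_refl) in HG; contradiction. }
      assert (Ht : ~ forces v true H).
      { intros Ht; apply HF; intros w' Hw HG; rewrite (Hw eq_refl); exact Ht. }
      (* [G] may itself be undecided, so [Gamma] need not prove it; its double negation suffices to
         derive [Bot]. *)
      apply HT_implI, (HT_contra _ (Neg G)).
      * apply (HT_contrapose _ _ H); [apply HT_hyp; left; reflexivity|].
        apply HT_cons, IHH, Ht.
      * apply HT_cons, decided_neg_neg; assumption.
    + intros HFt HFh a Ha.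
      (* An implication true there can fail here only at the here world itself. So [G] is true and
         [H] intermediate, and the implication takes the value of [H]. *)
      assert (Gh : forces v false G /\ ~ forces v false H).
      { apply NNPP; intros Hn; apply HFh; intros [] _ HG; [apply (HFt true); auto|].
        apply NNPP; intros Hh; apply Hn; split; assumption. }
      destruct Gh as [Gh Hh].
      assert (Ht : forces v true H) by (apply (HFt true (accessible_refl true)), HGf, Gh).
      destruct IHH as (_ & _ & IHH); destruct (IHH Ht Hh a Ha) as [HHa HaH]; split.
      * apply (HT_impl_trans _ _ H); [|exact HHa].
        apply HT_implI, (HT_mp _ G); [apply HT_hyp; left; reflexivity|].
        apply HT_cons, IHG, Gh.
      * apply (HT_impl_trans _ _ H); [exact HaH|].
        apply HT_implI, HT_const, HT_hyp; left; reflexivity.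
Qed.

(** If all axioms hold here, so does [F], which is then derived. If some axiom fails there, [Gamma]
    is inconsistent with it. In between, an axiom of intermediate value is provable, which collapses
    the interpretation; this is why truth of [F] there is a separate hypothesis. *)
Lemma HT_of_interp F :
  ((forall G, Ax G -> forces v false G) -> forces v false F) ->
  ((forall G, Ax G -> forces v true G) -> forces v true F) -> Gamma |- F.
Proof.
  intros Hh Ht.
  destruct (classic (forall G, Ax G -> forces v false G)) as [Axh|Axh];
    [apply decided_all, Hh, Axh|].
  destruct (classic (forall G, Ax G -> forces v true G)) as [Axt|Axt].
  - apply not_all_ex_not in Axh; destruct Axh as [G HG]; apply imply_to_and in HG.
    destruct HG as [HG HGh].
    destruct (decided_all F) as (F1 & _ & F3).
    destruct (classic (forces v false F)) as [Fh|Fh]; [auto|].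
    destruct (undecided_exists G (Axt G HG) HGh) as [a Ha].
    (* The axiom [G] is equivalent to the undecided atom [a], hence proves it, and [a] is in turn
       equivalent to [F]. *)
    apply (HT_mp _ (Atom a)); [apply F3; auto|].
    apply (HT_mp _ G); [apply (decided_all G); auto|apply HT_closed, HT_ax, HG].
  - apply not_all_ex_not in Axt; destruct Axt as [G HG]; apply imply_to_and in HG.
    destruct HG as [HG HGt].
    apply (HT_contra _ G); [apply HT_closed, HT_ax, HG|apply decided_all, HGt].
Qed.

End Decide.

(* The instances of weak excluded middle for atoms and of Hosoi's axiom for pairs
   of atoms; by distributivity one may choose a disjunct in each of them, and
   such a choice determines an HT-interpretation. *)
Definition split_index (t : A + A * A) : Type :=
  match t with inl _ => bool | inr _ => option bool end.

Definition split_case (t : A + A * A) : split_index t -> form A :=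
  match t with
  | inl a => fun b : bool => if b then Neg (Atom a) else Neg (Neg (Atom a))
  | inr (a, b) => fun i : option bool =>
      match i with
      | None => Atom a
      | Some true => Impl (Atom a) (Atom b)
      | Some false => Neg (Atom b)
      end
  end.

Lemma HT_split F :
  (forall c : forall t, split_index t,
     [Conj (fun t => split_case t (c t))] |- F) ->
  [] |- F.
Proof.
  intros H; destruct (classic (inhabited (A + A * A))) as [Hi|Hi].
  - eapply HT_cases; [|exact H].
    eapply HT_mp; [apply (HT_distr Ax _ split_index split_case Hi)|].
    apply HT_conjI; intros [a|[a b]].
    + apply HT_weak_em.
    + apply (HT_cases _ _ _ _ (HT_hosoi Ax (Atom a) (Atom b))); intros [].
      * apply (HT_disjI _ _ (option bool) _ None), HT_hyp; left; reflexivity.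
      * eapply HT_cases; [apply HT_hyp; left; reflexivity|]; intros b'.
        apply (HT_disjI _ _ (option bool) _ (Some b')), HT_hyp; left.
        destruct b'; reflexivity.
  (* Distributivity is available for non-empty families only; without atoms there is nothing to
     choose and the conjunction is empty. *)
  - assert (c : forall t, split_index t) by (intros t; destruct (Hi (inhabits t))).
    apply (HT_mp _ (Conj (fun t => split_case t (c t)))); [apply HT_implI, H|].
    apply HT_conjI; intros t; destruct (Hi (inhabits t)).
Qed.

Lemma HT_complete F :
  (forall v, monotone v -> (forall G, Ax G -> forces v false G) -> forces v false F) ->
  [] |- F.
Proof.
  intros HF; apply HT_split; intros c; set (Gamma := [_]).
  assert (Hc : forall t, Gamma |- split_case t (c t))
    by (intros t; apply (HT_conjE Ax Gamma _ (fun t => split_case t (c t)) t), HT_hyp;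
        left; reflexivity).
  (* The choice [false] at [a] is the disjunct [Neg (Neg (Atom a))]. *)
  set (there a := c (inl a) = false :> bool).
  (* [None] is the disjunct [Atom a] of Hosoi's axiom, so an atom counted as true here is derivable
     from the choice. *)
  set (here a := there a /\ exists b, there b /\ c (inr (a, b)) = None :> option bool).
  assert (Hthere : forall a, there a -> Gamma |- Neg (Neg (Atom a))).
  { intros a Ha; specialize (Hc (inl a)); unfold there in Ha; simpl in Hc.
    rewrite Ha in Hc; exact Hc. }
  apply (HT_of_interp (ht_interp here there)).
  - intros a [Ha _]; exact Ha.
  - intros a [_ (b & _ & Hb)]; specialize (Hc (inr (a, b))); simpl in Hc.
    rewrite Hb in Hc; exact Hc.
  - intros a Ha; specialize (Hc (inl a)); simpl in Ha, Hc; unfold there in Ha.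
    destruct (c (inl a)); [exact Hc|destruct Ha; reflexivity].
  - exact Hthere.
  - intros a b [Ha Hna] [Hb _]; simpl in *; specialize (Hc (inr (a, b))); simpl in Hc.
    destruct (c (inr (a, b))) as [[]|] eqn:E.
    + exact Hc.
    (* The choice asserts [Neg (Atom b)] although [b] is true there: it is inconsistent and proves
       everything. *)
    + apply HT_const, (HT_contra _ (Neg (Atom b))); auto.
    + destruct Hna; split; [exact Ha|]; exists b; auto.
  - intros Hax; apply HF; [intros a [Ha _]; exact Ha|exact Hax].
  - intros Hax.
    (* The collapsed interpretation is a monotone one of its own, to which the semantic hypothesis
       applies as well. *)
    assert (Hm : monotone (ht_interp there there)) by (intros a Ha; exact Ha).
    apply (forces_true_eq (ht_interp there there)); [reflexivity|].
    apply (forces_accessible _ _ Hm false); [auto|].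
    apply HF; [exact Hm|]; intros G HG; apply forces_total; [exact Hm|auto|].
    apply forces_true; apply (forces_true (ht_interp here there)), Hax, HG.
Qed.

Lemma HT_equivalent_iff F G :
  HT_equivalent Ax F G <->
  forall v, monotone v -> (forall K, Ax K -> forces v false K) ->
    forall w, forces v w F <-> forces v w G.
Proof.
  split.
  - intros H v Hv Hax w.
    assert (HFG : forces v w (Iff F G)) by (apply (HT_sound Ax [] _ v H Hv Hax); intros K []).
    rewrite forces_Iff in HFG; auto.
  - intros H; apply HT_complete; intros v Hv Hax; rewrite forces_Iff; auto.
Qed.

End Deduction.
End Semantics.

(** * Substitutions and values *)

Definition ground_subst (g : var -> precomp) : subst := fun x => Some (g x).

Lemma subst_term_ext s s' t : (forall x, In x (vars_term t) -> s x = s' x) ->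
  subst_term s t = subst_term s' t.
Proof.
  induction t as [r|x|op t1 IH1 t2 IH2]; simpl; intros H.
  - reflexivity.
  - rewrite (H x); auto.
  - rewrite IH1, IH2; auto; intros x Hx; apply H, in_or_app; auto.
Qed.

Lemma subst_atom_ext s s' a : (forall x, In x (vars_atom a) -> s x = s' x) ->
  subst_atom s a = subst_atom s' a.
Proof.
  intros H; unfold subst_atom; f_equal; apply map_ext_in; intros t Ht.
  apply subst_term_ext; intros x Hx; apply H, in_flat_map; eauto.
Qed.

Lemma subst_cond_ext s s' c : (forall x, In x (vars_cond c) -> s x = s' x) ->
  subst_cond s c = subst_cond s' c.
Proof.
  destruct c as [a|a|a|op t1 t2]; simpl; intros H; f_equal;
    (apply subst_atom_ext || apply subst_term_ext); auto;
    intros x Hx; apply H, in_or_app; auto.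
Qed.

Definition subst_comp (s s' : subst) : subst :=
  fun x => match s x with Some r => Some r | None => s' x end.

Lemma subst_term_comp s s' t :
  subst_term s' (subst_term s t) = subst_term (subst_comp s s') t.
Proof.
  induction t as [r|x|op t1 IH1 t2 IH2]; simpl; unfold subst_comp.
  - reflexivity.
  - destruct (s x); reflexivity.
  - rewrite IH1, IH2; reflexivity.
Qed.

Lemma subst_atom_comp s s' a :
  subst_atom s' (subst_atom s a) = subst_atom (subst_comp s s') a.
Proof.
  unfold subst_atom; simpl; f_equal; rewrite map_map; apply map_ext, subst_term_comp.
Qed.

Lemma subst_cond_comp s s' c :
  subst_cond s' (subst_cond s c) = subst_cond (subst_comp s s') c.
Proof.
  destruct c; simpl; rewrite ?subst_atom_comp, ?subst_term_comp; reflexivity.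
Qed.

Lemma vars_subst_term s t x :
  In x (vars_term (subst_term s t)) <-> In x (vars_term t) /\ s x = None.
Proof.
  induction t as [r|y|op t1 IH1 t2 IH2]; simpl.
  - tauto.
  - destruct (s y) eqn:E; simpl; split; [tauto| | |].
    + intros [[->|[]] Hs]; congruence.
    + intros [->|[]]; auto.
    + intros [[->|[]] _]; auto.
  - rewrite !in_app_iff, IH1, IH2; tauto.
Qed.

Lemma vars_subst_atom s a x :
  In x (vars_atom (subst_atom s a)) <-> In x (vars_atom a) /\ s x = None.
Proof.
  unfold vars_atom; simpl; rewrite !in_flat_map; split.
  - intros (t & Ht & Hx); apply in_map_iff in Ht; destruct Ht as (t' & <- & Ht').
    apply vars_subst_term in Hx; destruct Hx; eauto.
  - intros [(t & Ht & Hx) Hs]; exists (subst_term s t); split;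
      [apply in_map, Ht|apply vars_subst_term; auto].
Qed.

Lemma vars_subst_cond s c x :
  In x (vars_cond (subst_cond s c)) <-> In x (vars_cond c) /\ s x = None.
Proof.
  destruct c; simpl; try apply vars_subst_atom.
  rewrite !in_app_iff, !vars_subst_term; tauto.
Qed.

Lemma vars_subst_conds s L x :
  In x (vars_conds (map (subst_cond s) L)) <-> In x (vars_conds L) /\ s x = None.
Proof.
  unfold vars_conds; rewrite !in_flat_map; split.
  - intros (t & Ht & Hx); apply in_map_iff in Ht; destruct Ht as (t' & <- & Ht').
    apply vars_subst_cond in Hx; destruct Hx; eauto.
  - intros [(t & Ht & Hx) Hs]; exists (subst_cond s t); split;
      [apply in_map, Ht|apply vars_subst_cond; auto].
Qed.

Lemma tuple_subst_map g xs x : In x xs -> tuple_subst xs (map g xs) x = Some (g x).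
Proof.
  induction xs as [|y xs IH]; simpl; [intros []|].
  destruct (Nat.eq_dec x y) as [->|Hn]; [auto|].
  intros [->|Hx]; [destruct Hn|]; auto.
Qed.

Lemma in_values_Bin op t1 t2 z :
  In z (values (Bin op t1 t2)) <->
  exists m n k, In (Num m) (values t1) /\ In (Num n) (values t2) /\
                In k (binop_values op m n) /\ z = Num k.
Proof.
  simpl; rewrite in_flat_map; split.
  - intros (r1 & H1 & H); apply in_flat_map in H; destruct H as (r2 & H2 & H).
    destruct r1 as [m| | |], r2 as [n| | |]; try destruct H.
    apply in_map_iff in H; destruct H as (k & <- & Hk); exists m, n, k; auto.
  - intros (m & n & k & H1 & H2 & Hk & ->); exists (Num m); split; [exact H1|].
    apply in_flat_map; exists (Num n); split; [exact H2|]; apply in_map, Hk.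
Qed.

Lemma interval_free_subst s t : interval_free t -> interval_free (subst_term s t).
Proof.
  induction t as [r|x|op t1 IH1 t2 IH2]; simpl; [auto|destruct (s x); simpl; auto|tauto].
Qed.

(** Intervals are the only source of several values. Hence the default [Bot] in [tau_count] is
    reached only when there is no value at all. *)
Lemma interval_free_values t : interval_free t -> length (values t) <= 1.
Proof.
  induction t as [r|x|op t1 IH1 t2 IH2]; simpl; auto.
  intros (Hop & H1 & H2); apply IH1 in H1; apply IH2 in H2.
  destruct (values t1) as [|r1 [|]]; simpl in *; try lia.
  destruct (values t2) as [|r2 [|]]; simpl in *; try lia.
  rewrite !app_nil_r; destruct r1, r2; simpl; auto.
  destruct op; simpl; [auto| | |destruct Hop; reflexivity];
    destruct Z.eq_dec; simpl; auto.
Qed.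

(** The inequalities say that the remainder does not have the sign opposite to the dividend's and is
    smaller than the divisor in absolute value, which characterizes division rounding toward
    zero. *)
Lemma quot_rem_spec a b q r : b <> 0%Z ->
  (a = b * q + r /\ r * a >= 0 /\ r * r < b * b <->
   q = Z.quot a b /\ r = a - b * Z.quot a b)%Z.
Proof.
  intros Hb; split.
  - intros (E & Hs & Hlt).
    assert (Habs : (Z.abs r < Z.abs b)%Z).
    { apply Z.square_lt_simpl_nonneg; [lia|].
      rewrite !Z.abs_square; exact Hlt. }
    assert (Hq : q = Z.quot a b).
    { apply Zquot_unique_full with (r := r); [|exact E].
      unfold Remainder.
      destruct (Z.lt_trichotomy a 0) as [Ha|[Ha|Ha]].
      - right; assert (r <= 0)%Z by nia; lia.
      (* For a zero dividend the sign condition is void, but the size bound still forces [q = 0] and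
         hence [r = 0]. *)
      - left; subst a; assert (q = 0)%Z by nia; nia.
      - left; assert (0 <= r)%Z by nia; lia. }
    subst q; split; [reflexivity|lia].
  - intros [-> ->]; pose proof (Z.quot_rem a b Hb) as E.
    pose proof (Z.rem_bound_abs a b Hb) as Hlt.
    pose proof (Z.rem_sign_mul a b Hb) as Hs.
    replace (a - b * Z.quot a b)%Z with (Z.rem a b) by lia.
    split; [lia|split; [lia|]].
    rewrite <- (Z.abs_square (Z.rem a b)), <- (Z.abs_square b); nia.
Qed.

(** * Semantics of first-order formulas under grounding *)

(** Describes the assignments reached from [g] by a block of quantifiers over [xs]. *)
Definition agree_off (xs : list var) (g g' : var -> precomp) : Prop :=
  forall y, ~ In y xs -> g' y = g y.

Lemma agree_off_assign g xs rs : NoDup xs -> length rs = length xs ->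
  exists g', agree_off xs g g' /\ map g' xs = rs.
Proof.
  revert rs; induction xs as [|x xs IH]; intros [|r rs] Hnd Hlen; try discriminate.
  - exists g; split; [intros y _|]; reflexivity.
  - inversion Hnd as [|? ? Hx Hnd']; subst.
    destruct (IH rs Hnd') as (g' & Hg' & Hm); [simpl in Hlen; lia|].
    exists (upd g' x r); split.
    + intros y Hy; unfold upd; destruct Nat.eq_dec as [->|Hn].
      * destruct Hy; left; reflexivity.
      * apply Hg'; intros H; apply Hy; right; exact H.
    + simpl; f_equal; [unfold upd; destruct Nat.eq_dec; congruence|].
      rewrite <- Hm; apply map_ext_in; intros y Hy; unfold upd.
      destruct Nat.eq_dec; [subst; contradiction|reflexivity].
Qed.

Lemma upd_eq {T} (f : nat -> T) x a : upd f x a x = a.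
Proof. unfold upd; destruct Nat.eq_dec; congruence. Qed.

Lemma upd_neq {T} (f : nat -> T) x a y : y <> x -> upd f x a y = f y.
Proof. unfold upd; destruct Nat.eq_dec; congruence. Qed.

Lemma lt_fresh x xs : In x xs -> x < fresh xs.
Proof.
  intros Hx; unfold fresh; apply Nat.lt_succ_r.
  apply (proj1 (Forall_forall _ _) (proj1 (list_max_le xs _) (le_n _)) x Hx).
Qed.

Section Ground.

Context (le : precomp -> precomp -> Prop).

Lemma iterm_eval_ext h h' a : (forall i, In (Int i) (iterm_vars a) -> h i = h' i) ->
  iterm_eval h a = iterm_eval h' a.
Proof.
  induction a as [n|i|op a IHa b IHb]; simpl; intros H; auto.
  rewrite IHa, IHb; auto; intros i Hi; apply H, in_or_app; auto.
Qed.

Lemma gterm_eval_ext g g' h h' t :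
  (forall x, In (Gen x) (gterm_vars t) -> g x = g' x) ->
  (forall i, In (Int i) (gterm_vars t) -> h i = h' i) ->
  gterm_eval g h t = gterm_eval g' h' t.
Proof.
  destruct t; simpl; intros Hg Hh; auto.
  f_equal; apply iterm_eval_ext, Hh.
Qed.

Section Formulas.

Context {P : Type} (v : bool -> P * list precomp -> Prop).
Implicit Types F G : fo P.

Definition fo_forces (w : bool) (g : var -> precomp) (h : nat -> Z) F : Prop :=
  forces v w (ground le g h F).

Lemma fo_forces_ext F : forall w g g' h h',
  (forall x, In (Gen x) (free_vars F) -> g x = g' x) ->
  (forall i, In (Int i) (free_vars F) -> h i = h' i) ->
  fo_forces w g h F <-> fo_forces w g' h' F.
Proof.
  unfold fo_forces.
  induction F as [|op t1 t2|p ts|F IHF G IHG|F IHF G IHG|F IHF G IHG|[x|i] F IH|[x|i] F IH];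
    simpl ground; simpl free_vars; intros w g g' h h' Hg Hh.
  - reflexivity.
  - rewrite !forces_truth, (gterm_eval_ext g g' h h' t1), (gterm_eval_ext g g' h h' t2);
      [reflexivity|..]; intros y Hy; (apply Hg || apply Hh); apply in_or_app; auto.
  - simpl; replace (map (gterm_eval g h) ts) with (map (gterm_eval g' h') ts); [reflexivity|].
    apply map_ext_in; intros t Ht; symmetry; apply gterm_eval_ext; intros y Hy;
      (apply Hg || apply Hh); apply in_flat_map; eauto.
  - rewrite !forces_And, (IHF w g g' h h'), (IHG w g g' h h'); [reflexivity|..];
      intros y Hy; (apply Hg || apply Hh); apply in_or_app; auto.
  - rewrite !forces_Or, (IHF w g g' h h'), (IHG w g g' h h'); [reflexivity|..];
      intros y Hy; (apply Hg || apply Hh); apply in_or_app; auto.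
  - apply forces_Impl_iff; intros w'; [apply IHF|apply IHG];
      intros y Hy; (apply Hg || apply Hh); apply in_or_app; auto.
  - assert (E : forall r w', forces v w' (ground le (upd g x r) h F) <->
                          forces v w' (ground le (upd g' x r) h' F)).
    { intros r w'; apply IH; intros y Hy.
      - unfold upd; destruct Nat.eq_dec as [|Hn]; auto; apply Hg, in_in_remove; congruence.
      - apply Hh, in_in_remove; congruence. }
    simpl; split; intros H r; apply E, H.
  - assert (E : forall r w', forces v w' (ground le g (upd h i r) F) <->
                          forces v w' (ground le g' (upd h' i r) F)).
    { intros r w'; apply IH; intros y Hy.
      - apply Hg, in_in_remove; congruence.
      - unfold upd; destruct Nat.eq_dec as [|Hn]; auto; apply Hh, in_in_remove; congruence. }
    simpl; split; intros H r; apply E, H.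
  - assert (E : forall r w', forces v w' (ground le (upd g x r) h F) <->
                          forces v w' (ground le (upd g' x r) h' F)).
    { intros r w'; apply IH; intros y Hy.
      - unfold upd; destruct Nat.eq_dec as [|Hn]; auto; apply Hg, in_in_remove; congruence.
      - apply Hh, in_in_remove; congruence. }
    simpl; split; intros [r H]; exists r; apply E, H.
  - assert (E : forall r w', forces v w' (ground le g (upd h i r) F) <->
                          forces v w' (ground le g' (upd h' i r) F)).
    { intros r w'; apply IH; intros y Hy.
      - apply Hg, in_in_remove; congruence.
      - unfold upd; destruct Nat.eq_dec as [|Hn]; auto; apply Hh, in_in_remove; congruence. }
    simpl; split; intros [r H]; exists r; apply E, H.
Qed.

Lemma fo_forces_And w g h F G :
  fo_forces w g h (FAnd F G) <-> fo_forces w g h F /\ fo_forces w g h G.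
Proof. apply forces_And. Qed.

Lemma fo_forces_Imp w g h F G :
  fo_forces w g h (FImp F G) <->
  forall w', accessible w w' -> fo_forces w' g h F -> fo_forces w' g h G.
Proof. reflexivity. Qed.

Lemma fo_forces_Neg w g h F :
  fo_forces w g h (FNeg F) <-> forall w', accessible w w' -> ~ fo_forces w' g h F.
Proof. apply (forces_Neg v w (ground le g h F)). Qed.

Lemma fo_forces_Top w g h : fo_forces w g h FTop.
Proof. intros w' _ H; exact H. Qed.

Lemma fo_forces_Bot w g h : ~ fo_forces w g h FBot.
Proof. intros [[] _]. Qed.

Lemma fo_forces_Cmp w g h op t1 t2 :
  fo_forces w g h (FCmp op t1 t2) <-> cmp_holds le op (gterm_eval g h t1) (gterm_eval g h t2).
Proof. apply forces_truth. Qed.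

Lemma fo_forces_Conj w g h Fs :
  fo_forces w g h (FConj Fs) <-> forall F, In F Fs -> fo_forces w g h F.
Proof.
  induction Fs as [|F [|G Gs] IH].
  - split; [intros _ F []|intros _; apply fo_forces_Top].
  - simpl; split; [intros H F' [<-|[]]; exact H|auto].
  - change (FConj (F :: G :: Gs)) with (FAnd F (FConj (G :: Gs))).
    rewrite fo_forces_And, IH; split.
    + intros [HF HG] K [<-|HK]; auto.
    + intros H; split; [apply H; left; reflexivity|intros K HK; apply H; right; exact HK].
Qed.

Lemma fo_forces_Disj w g h Fs :
  fo_forces w g h (FDisj Fs) <-> exists F, In F Fs /\ fo_forces w g h F.
Proof.
  induction Fs as [|F [|G Gs] IH].
  - split; [intros H; destruct (fo_forces_Bot _ _ _ H)|intros (F & [] & _)].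
  - simpl; split; [intros H; exists F; auto|intros (F' & [<-|[]] & H); exact H].
  - change (fo_forces w g h (FDisj (F :: G :: Gs))) with
      (forces v w (Or (ground le g h F) (ground le g h (FDisj (G :: Gs))))).
    rewrite forces_Or; unfold fo_forces in *; rewrite IH; split.
    + intros [HF|(K & HK & HF)]; [exists F|exists K]; simpl in *; auto.
    + intros (K & [<-|HK] & HF); [left; exact HF|right; exists K; auto].
Qed.

Lemma fo_forces_Exs w g h xs F :
  fo_forces w g h (FExs (map Gen xs) F) <->
  exists g', agree_off xs g g' /\ fo_forces w g' h F.
Proof.
  revert g; induction xs as [|x xs IH]; intros g.
  - simpl; split.
    + intros H; exists g; split; [intros y _; reflexivity|exact H].
    + intros (g' & Hg & H); replace g with g'; [exact H|].
      apply functional_extensionality; intros y; apply Hg; intros [].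
  - transitivity (exists r, fo_forces w (upd g x r) h (FExs (map Gen xs) F)); [reflexivity|].
    split.
    + intros [r H]; apply IH in H; destruct H as (g' & Hg & H); exists g'; split; [|exact H].
      intros y Hy; rewrite Hg by (intros H'; apply Hy; right; exact H').
      apply upd_neq; intros ->; apply Hy; left; reflexivity.
    + intros (g' & Hg & H); exists (g' x); apply IH; exists g'; split; [|exact H].
      intros y Hy; unfold upd; destruct Nat.eq_dec as [->|Hn]; [reflexivity|].
      apply Hg; intros [->|H']; auto.
Qed.

Lemma fo_forces_Alls w g h vs F :
  fo_forces w g h (FAlls vs F) <->
  forall g' h', agree_off (general_vars vs) g g' ->
    (forall i, ~ In (Int i) vs -> h' i = h i) -> fo_forces w g' h' F.
Proof.
  revert g h; induction vs as [|[x|i] vs IH]; intros g h.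
  - simpl; split.
    + intros H g' h' Hg Hh; replace g' with g; [replace h' with h; [exact H|]|];
        apply functional_extensionality; intros y; symmetry; [apply Hh|apply Hg]; intros [].
    + intros H; apply H; [intros y _|]; reflexivity.
  - transitivity (forall r, fo_forces w (upd g x r) h (FAlls vs F)); [reflexivity|].
    split.
    + intros H g' h' Hg Hh; apply (proj1 (IH _ _) (H (g' x))).
      * intros y Hy; unfold upd; destruct Nat.eq_dec as [->|Hn]; [reflexivity|].
        apply Hg; intros [->|H']; auto.
      * intros j Hj; apply Hh; intros [H'|H']; [discriminate|contradiction].
    + intros H r; apply IH; intros g' h' Hg Hh; apply H.
      * intros y Hy; rewrite Hg by (intros H'; apply Hy; right; exact H').
        apply upd_neq; intros ->; apply Hy; left; reflexivity.
      * intros j Hj; apply Hh; intros H'; apply Hj; right; exact H'.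
  - transitivity (forall n, fo_forces w g (upd h i n) (FAlls vs F)); [reflexivity|].
    split.
    + intros H g' h' Hg Hh; apply (proj1 (IH _ _) (H (h' i))).
      * exact Hg.
      * intros j Hj; unfold upd; destruct Nat.eq_dec as [->|Hn]; [reflexivity|].
        apply Hh; intros [E|H']; [injection E as ->; auto|contradiction].
    + intros H n; apply IH; intros g' h' Hg Hh; apply H; [exact Hg|].
      intros j Hj; rewrite Hh by (intros H'; apply Hj; right; exact H').
      apply upd_neq; intros ->; apply Hj; left; reflexivity.
Qed.

Lemma general_vars_map_Gen xs : general_vars (map Gen xs) = xs.
Proof. induction xs as [|x xs IH]; simpl; [|f_equal]; auto. Qed.

Lemma fo_forces_Alls_Gen w g h xs F :
  fo_forces w g h (FAlls (map Gen xs) F) <->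
  forall g', agree_off xs g g' -> fo_forces w g' h F.
Proof.
  rewrite fo_forces_Alls, general_vars_map_Gen; split.
  - intros H g' Hg; apply H; auto.
  - intros H g' h' Hg Hh; replace h' with h; [auto|].
    apply functional_extensionality; intros i; symmetry; apply Hh.
    intros Hi; apply in_map_iff in Hi; destruct Hi as (x & E & _); discriminate.
Qed.

Lemma fo_forces_universal_closure w g h F :
  fo_forces w g h (universal_closure F) <-> forall g' h', fo_forces w g' h' F.
Proof.
  unfold universal_closure; rewrite fo_forces_Alls; split; [|auto].
  intros H g' h'; set (vs := nodup fovar_eq_dec (free_vars F)) in *.
  (* Variables outside the closure keep their initial values; the mixed assignments are thus reached
     by the quantifier block and agree with [g'] and [h'] on all free variables. *)
  apply (fo_forces_ext F w (fun x => if in_dec fovar_eq_dec (Gen x) vs then g' x else g x) g'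
           (fun i => if in_dec fovar_eq_dec (Int i) vs then h' i else h i) h').
  - intros x Hx; destruct in_dec as [|Hn]; [reflexivity|]; destruct Hn; apply nodup_In, Hx.
  - intros x Hx; destruct in_dec as [|Hn]; [reflexivity|]; destruct Hn; apply nodup_In, Hx.
  - apply H.
    + intros x Hx; destruct in_dec as [Hi|]; [|reflexivity]; destruct Hx.
      apply in_flat_map; exists (Gen x); split; [exact Hi|left; reflexivity].
    + intros i Hi; destruct in_dec; [contradiction|reflexivity].
Qed.

End Formulas.

Context (Hle : precomp_order le).

(** * The formulas val and tau^B *)

Definition ground_values (g : var -> precomp) (t : term) : list precomp :=
  values (subst_term (ground_subst g) t).

Definition int_vars_below (k : nat) (Z : gterm) : Prop :=
  forall i, In (Int i) (gterm_vars Z) -> i < k.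

Lemma cmp_holds_Num op m n :
  cmp_holds le op (Num m) (Num n) <->
  match op with
  | CEq => m = n
  | CNe => m <> n
  | CLt => m < n
  | CGt => m > n
  | CLe => m <= n
  | CGe => m >= n
  end%Z.
Proof.
  assert (E : forall m n, Num m = Num n <-> m = n) by (split; congruence).
  destruct op; simpl; rewrite ?(po_num le Hle), ?E; lia.
Qed.

(** The witnesses occupy the integer variables [k] to [k + 3], above those of [Z] and below those
    bound in the subterms, so choosing them changes neither the value of [Z] nor one another. *)
Lemma fo_forces_val {P} (v : bool -> P * list precomp -> Prop) w g t :
  forall k Z h, int_vars_below k Z ->
  fo_forces v w g h (val k t Z) <-> In (gterm_eval g h Z) (ground_values g t).
Proof.
  induction t as [r|x|op t1 IH1 t2 IH2]; intros k Z h HZ.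
  - simpl; rewrite fo_forces_Cmp; simpl.
    replace (gterm_eval g h (gpre r)) with r by (destruct r; reflexivity).
    split; [auto|intros [H|[]]; auto].
  - simpl; rewrite fo_forces_Cmp; simpl; split; [auto|intros [H|[]]; auto].
  - unfold ground_values; cbn [subst_term]; rewrite in_values_Bin.
    fold (ground_values g t1); fold (ground_values g t2).
    assert (Hvar : forall i j, j < i -> int_vars_below i (GInt (IVar j))).
    { intros i j Hij l [E|[]]; injection E as <-; exact Hij. }
    assert (HZh : forall h', (forall i, i < k -> h' i = h i) ->
                    gterm_eval g h' Z = gterm_eval g h Z).
    { intros h' Hh'; apply gterm_eval_ext; [reflexivity|]; intros i Hi; apply Hh', HZ, Hi. }
    assert (Hk1 : k < k + 1) by lia.
    (* Quotient and remainder share one formula up to its last conjunct and are handled together. *)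
    assert (Hquot : forall is_mod : bool, let o := if is_mod then Mod else Div in
      fo_forces v w g h (val k (Bin o t1 t2) Z) <->
      exists m n z, In (Num m) (ground_values g t1) /\ In (Num n) (ground_values g t2) /\
                    In z (binop_values o m n) /\ gterm_eval g h Z = Num z).
    { intros is_mod o.
      transitivity (exists m n q r, fo_forces v w g
          (upd (upd (upd (upd h k m) (k + 1) n) (k + 2) q) (k + 3) r)
        (FConj [val (k + 4) t1 (GInt (IVar k));
                val (k + 4) t2 (GInt (IVar (k + 1)));
                FCmp CNe (GInt (IVar (k + 1))) (GInt (INum 0));
                FCmp CEq (GInt (IVar k))
                  (GInt (IOp OAdd (IOp OMul (IVar (k + 1)) (IVar (k + 2))) (IVar (k + 3))));
                FCmp CGe (GInt (IOp OMul (IVar (k + 3)) (IVar k))) (GInt (INum 0));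
                FCmp CLt (GInt (IOp OMul (IVar (k + 3)) (IVar (k + 3))))
                  (GInt (IOp OMul (IVar (k + 1)) (IVar (k + 1))));
                FCmp CEq Z (GInt (IVar (if is_mod then k + 3 else k + 2)))]));
        [destruct is_mod; reflexivity|].
      match goal with |- (exists m n q r, @?F m n q r) <-> _ =>
        assert (E : forall m n q r, F m n q r <->
          In (Num m) (ground_values g t1) /\ In (Num n) (ground_values g t2) /\
          n <> 0%Z /\ (m = n * q + r)%Z /\ (r * m >= 0)%Z /\ (r * r < n * n)%Z /\
          gterm_eval g h Z = Num (if is_mod then r else q)) end.
      { intros m n q r; unfold FConj.
        rewrite !fo_forces_And, !fo_forces_Cmp, IH1, IH2 by (apply Hvar; lia).
        cbn [gterm_eval]; rewrite !cmp_holds_Num; cbn [iterm_eval arith_eval cmp_holds].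
        rewrite HZh by (intros i Hi; rewrite !upd_neq by lia; reflexivity).
        destruct is_mod; repeat (rewrite upd_eq || rewrite upd_neq by lia); reflexivity. }
      assert (Hz : forall m n z, In z (binop_values o m n) <->
        n <> 0%Z /\ z = if is_mod then (m - n * Z.quot m n)%Z else Z.quot m n).
      { intros m n z; unfold o; destruct is_mod; simpl; destruct Z.eq_dec; simpl;
          intuition congruence. }
      split.
      * intros (m & n & q & r & H); apply E in H.
        destruct H as (H1 & H2 & Hn & H3 & H4 & H5 & ->).
        destruct (proj1 (quot_rem_spec m n q r Hn)) as [-> ->]; [auto|].
        exists m, n; eexists; rewrite Hz; eauto.
      * intros (m & n & z & H1 & H2 & Hzo & HZ'); apply Hz in Hzo; destruct Hzo as [Hn ->].
        exists m, n, (Z.quot m n), (m - n * Z.quot m n)%Z; apply E.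
        pose proof (proj2 (quot_rem_spec m n _ _ Hn) (conj eq_refl eq_refl)).
        destruct is_mod; tauto. }
    destruct op as [op| | |].
    + transitivity (exists m n, fo_forces v w g (upd (upd h k m) (k + 1) n)
        (FConj [FCmp CEq Z (GInt (IOp op (IVar k) (IVar (k + 1))));
                val (k + 4) t1 (GInt (IVar k)); val (k + 4) t2 (GInt (IVar (k + 1)))]));
        [reflexivity|].
      assert (E : forall m n, fo_forces v w g (upd (upd h k m) (k + 1) n)
        (FConj [FCmp CEq Z (GInt (IOp op (IVar k) (IVar (k + 1))));
                val (k + 4) t1 (GInt (IVar k)); val (k + 4) t2 (GInt (IVar (k + 1)))]) <->
        gterm_eval g h Z = Num (arith_eval op m n) /\
        In (Num m) (ground_values g t1) /\ In (Num n) (ground_values g t2)).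
      { intros m n; unfold FConj.
        rewrite !fo_forces_And, fo_forces_Cmp, IH1, IH2 by (apply Hvar; lia).
        simpl; rewrite upd_eq, (upd_neq _ (k + 1) n k), upd_eq by lia.
        rewrite HZh; [reflexivity|]; intros i Hi; rewrite !upd_neq by lia; reflexivity. }
      split.
      * intros (m & n & H); apply E in H; exists m, n, (arith_eval op m n); simpl; tauto.
      * intros (m & n & z & H1 & H2 & [<-|[]] & HZ'); exists m, n; apply E; auto.
    + exact (Hquot false).
    + exact (Hquot true).
    + transitivity (exists m n z, fo_forces v w g
          (upd (upd (upd h k m) (k + 1) n) (k + 2) z)
        (FConj [val (k + 4) t1 (GInt (IVar k));
                val (k + 4) t2 (GInt (IVar (k + 1)));
                FCmp CLe (GInt (IVar k)) (GInt (IVar (k + 2)));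
                FCmp CLe (GInt (IVar (k + 2))) (GInt (IVar (k + 1)));
                FCmp CEq Z (GInt (IVar (k + 2)))])); [reflexivity|].
      match goal with |- (exists m n z, @?F m n z) <-> _ =>
        assert (E : forall m n z, F m n z <->
          In (Num m) (ground_values g t1) /\ In (Num n) (ground_values g t2) /\
          (m <= z)%Z /\ (z <= n)%Z /\ gterm_eval g h Z = Num z) end.
      { intros m n z; unfold FConj.
        rewrite !fo_forces_And, !fo_forces_Cmp, IH1, IH2 by (apply Hvar; lia).
        cbn [gterm_eval]; rewrite !cmp_holds_Num; cbn [iterm_eval arith_eval cmp_holds].
        rewrite HZh by (intros i Hi; rewrite !upd_neq by lia; reflexivity).
        repeat (rewrite upd_eq || rewrite upd_neq by lia); reflexivity. }
      assert (Hint : forall m n z, In z (binop_values Interval m n) <-> (m <= z <= n)%Z).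
      { intros m n z; simpl; rewrite in_map_iff; split.
        - intros (i & <- & Hi); apply in_seq in Hi; lia.
        - intros Hz; exists (Z.to_nat (z - m)); split; [lia|]; apply in_seq; lia. }
      split.
      * intros (m & n & z & H); apply E in H; exists m, n, z; rewrite Hint; tauto.
      * intros (m & n & z & H); rewrite Hint in H; exists m, n, z; apply E; tauto.
Qed.

Lemma fo_forces_val_tuple {P} (v : bool -> P * list precomp -> Prop) w g h ts Zs :
  length Zs = length ts ->
  fo_forces v w g h (val_tuple ts Zs) <->
  tuple_values (map (subst_term (ground_subst g)) ts) (map g Zs).
Proof.
  intros Hlen; unfold val_tuple; rewrite fo_forces_Conj; unfold tuple_values.
  revert Zs Hlen; induction ts as [|t ts IH]; intros [|Z Zs] Hlen; try discriminate; simpl.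
  - split; [constructor|intros _ F []].
  - specialize (IH Zs); split.
    + intros H; constructor.
      * apply (fo_forces_val v w g t 0 (GVar Z) h); [intros i [E|[]]; discriminate|].
        apply H; left; reflexivity.
      * apply IH; [simpl in Hlen; lia|]; auto.
    + intros H; inversion H as [|? ? ? ? Ht Hts]; subst.
      intros F [<-|HF].
      * apply fo_forces_val; [intros i [E|[]]; discriminate|exact Ht].
      * apply IH; [simpl in Hlen; lia|exact Hts|exact HF].
Qed.

Lemma Forall2_len {T U} (R : T -> U -> Prop) l l' : Forall2 R l l' -> length l' = length l.
Proof. intros H; symmetry; exact (Forall2_length H). Qed.

Lemma agree_off_ground_subst g g' xs x : agree_off xs g g' -> ~ In x xs ->
  ground_subst g' x = ground_subst g x.
Proof. intros H Hx; unfold ground_subst; f_equal; apply H, Hx. Qed.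

Lemma map_subst_ext s s' ts : (forall x, In x (flat_map vars_term ts) -> s x = s' x) ->
  map (subst_term s) ts = map (subst_term s') ts.
Proof.
  intros H; apply map_ext_in; intros t Ht; apply subst_term_ext.
  intros x Hx; apply H, in_flat_map; eauto.
Qed.

Lemma not_in_seq_fresh x xs n : In x xs -> ~ In x (seq (fresh xs) n).
Proof. intros Hx Hs; apply in_seq in Hs; pose proof (lt_fresh x xs Hx); lia. Qed.

(** The three kinds of literals differ only in [F]. As [Zs] is fresh for the atom, the values of its
    arguments do not change when [Zs] is assigned. *)
Lemma fo_forces_tauB_atom v w g h a (F : list gterm -> fo0) (Q : list precomp -> Prop) :
  (forall g' ts, fo_forces v w g' h (F ts) <-> Q (map (gterm_eval g' h) ts)) ->
  fo_forces v w g h (tauB_atom a F) <->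
  exists rs, tuple_values (aargs (subst_atom (ground_subst g) a)) rs /\ Q rs.
Proof.
  intros HF; unfold tauB_atom; simpl; set (Zs := seq _ _).
  assert (HZ : length Zs = length (aargs a)) by apply length_seq.
  assert (E : forall g', agree_off Zs g g' ->
    fo_forces v w g' h (FAnd (val_tuple (aargs a) Zs) (F (map GVar Zs))) <->
    tuple_values (map (subst_term (ground_subst g)) (aargs a)) (map g' Zs) /\ Q (map g' Zs)).
  { intros g' Hg; rewrite fo_forces_And, (fo_forces_val_tuple v w g' h _ Zs HZ), HF, map_map.
    simpl; rewrite (map_subst_ext (ground_subst g') (ground_subst g)); [reflexivity|].
    intros x Hx; apply (agree_off_ground_subst g g' Zs x Hg), not_in_seq_fresh, Hx. }
  rewrite fo_forces_Exs; split.
  - intros (g' & Hg & H); exists (map g' Zs); apply E, H; exact Hg.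
  - intros (rs & Hrs & HQ).
    destruct (agree_off_assign g Zs rs) as (g' & Hg & Hm); [apply seq_NoDup| |].
    + rewrite (Forall2_len _ _ _ Hrs); simpl; rewrite length_map; symmetry; exact HZ.
    + exists g'; split; [exact Hg|]; apply E; [exact Hg|]; rewrite Hm; auto.
Qed.

Lemma fo_forces_tauB (v : bool -> patom -> Prop) w g h c :
  fo_forces v w g h (tauB c) <-> forces v w (tau_cond le (subst_cond (ground_subst g) c)).
Proof.
  destruct c as [a|a|a|op t1 t2].
  - cbn [tauB tau_cond subst_cond]; rewrite forces_DisjOver.
    apply fo_forces_tauB_atom; reflexivity.
  - cbn [tauB tau_cond subst_cond]; rewrite forces_DisjOver.
    apply fo_forces_tauB_atom; reflexivity.
  - cbn [tauB tau_cond subst_cond]; rewrite forces_DisjOver.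
    apply fo_forces_tauB_atom; reflexivity.
  - cbn [tauB tau_cond subst_cond]; rewrite forces_truth.
    set (Z1 := fresh _); change [Gen Z1; Gen (S Z1)] with (map Gen [Z1; S Z1]).
    rewrite fo_forces_Exs.
    assert (E : forall g', agree_off [Z1; S Z1] g g' ->
      fo_forces v w g' h (FConj [val 0 t1 (GVar Z1); val 0 t2 (GVar (S Z1));
                                 FCmp op (GVar Z1) (GVar (S Z1))]) <->
      In (g' Z1) (ground_values g t1) /\ In (g' (S Z1)) (ground_values g t2) /\
      cmp_holds le op (g' Z1) (g' (S Z1))).
    { intros g' Hg; unfold FConj.
      rewrite !fo_forces_And, fo_forces_Cmp, !fo_forces_val
        by (intros i [Hi|[]]; discriminate).
      unfold ground_values; simpl.
      rewrite (subst_term_ext (ground_subst g') (ground_subst g) t1),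
        (subst_term_ext (ground_subst g') (ground_subst g) t2); [reflexivity|..];
        intros x Hx; apply (agree_off_ground_subst g g' [Z1; S Z1] x Hg);
        assert (Hx' : In x (vars_term t1 ++ vars_term t2)) by (apply in_or_app; auto);
        pose proof (lt_fresh x _ Hx') as Hlt; fold Z1 in Hlt; intros [Hx1|[Hx1|[]]]; lia. }
    split.
    + intros (g' & Hg & H); apply E in H; [|exact Hg]; exists (g' Z1), (g' (S Z1)); exact H.
    + intros (r1 & r2 & H).
      destruct (agree_off_assign g [Z1; S Z1] [r1; r2]) as (g' & Hg & Hm);
        [apply (seq_NoDup 2 Z1)|reflexivity|].
      injection Hm as E1 E2; exists g'; split; [exact Hg|]; apply E; [exact Hg|].
      rewrite E1, E2; exact H.
Qed.

Lemma fo_forces_tauB_conds (v : bool -> patom -> Prop) w g h L :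
  fo_forces v w g h (tauB_conds L) <->
  forces v w (tau_conds le (map (subst_cond (ground_subst g)) L)).
Proof.
  unfold tauB_conds, tau_conds; rewrite fo_forces_Conj, forces_ConjOver; split.
  - intros H c Hc; apply in_map_iff in Hc; destruct Hc as (c' & <- & Hc').
    apply (fo_forces_tauB v w g h), H, in_map, Hc'.
  - intros H F HF; apply in_map_iff in HF; destruct HF as (c & <- & Hc).
    apply fo_forces_tauB, H, in_map, Hc.
Qed.

(** * Free variables *)

Lemma free_vars_Exs {P} vs (F : fo P) x :
  In x (free_vars (FExs vs F)) -> In x (free_vars F) /\ ~ In x vs.
Proof.
  induction vs as [|y vs IH]; simpl; [auto|].
  intros Hx; apply in_remove in Hx; destruct Hx as [Hx Hn]; apply IH in Hx.
  split; [apply Hx|intros [->|H]; [auto|apply Hx, H]].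
Qed.

Lemma free_vars_Conj {P} (Fs : list (fo P)) x :
  In x (free_vars (FConj Fs)) -> exists F, In F Fs /\ In x (free_vars F).
Proof.
  induction Fs as [|F [|G Gs] IH]; [intros []|exists F; simpl; auto|].
  intros Hx; change (In x (free_vars F ++ free_vars (FConj (G :: Gs)))) in Hx.
  apply in_app_or in Hx; destruct Hx as [Hx|Hx]; [exists F; simpl; auto|].
  destruct (IH Hx) as (K & HK & HxK); exists K; simpl in *; auto.
Qed.

Lemma free_vars_val {P} t : forall k Z x,
  In x (free_vars (val (P := P) k t Z)) ->
  In x (map Gen (vars_term t)) \/ In x (gterm_vars Z).
Proof.
  induction t as [r|y|op t1 IH1 t2 IH2]; intros k Z x Hx.
  - simpl in Hx; apply in_app_or in Hx; destruct Hx as [Hx|Hx]; [auto|].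
    destruct r; destruct Hx.
  - simpl in *; apply in_app_or in Hx; tauto.
  - simpl vars_term; rewrite map_app, in_app_iff.
    destruct op as [op| | |]; simpl val in Hx;
      (apply free_vars_Exs in Hx || apply (free_vars_Exs [_; _; _; _]) in Hx
        || apply (free_vars_Exs [_; _; _]) in Hx || apply (free_vars_Exs [_; _]) in Hx);
      destruct Hx as [Hx Hn]; simpl in Hn; cbn [free_vars gterm_vars iterm_vars app] in Hx;
      repeat (apply in_app_or in Hx; destruct Hx as [Hx|Hx]);
      try (apply IH1 in Hx); try (apply IH2 in Hx); simpl in Hx;
      rewrite ?in_app_iff in Hx; simpl in Hx; tauto.
Qed.

Lemma free_vars_val_tuple {P} ts Zs x :
  In x (free_vars (val_tuple (P := P) ts Zs)) ->
  In x (map Gen (flat_map vars_term ts)) \/ In x (map Gen Zs).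
Proof.
  intros Hx; apply free_vars_Conj in Hx; destruct Hx as (F & HF & Hx).
  apply in_map_iff in HF; destruct HF as ([t Z] & <- & HtZ); simpl in Hx.
  apply free_vars_val in Hx; destruct Hx as [Hx|[<-|[]]].
  - left; apply in_map_iff in Hx; destruct Hx as (y & <- & Hy).
    apply in_map, in_flat_map; exists t; split; [exact (in_combine_l _ _ _ _ HtZ)|exact Hy].
  - right; apply in_map, (in_combine_r _ _ _ _ HtZ).
Qed.

Lemma free_vars_tauB_atom a (F : list gterm -> fo0) x :
  (forall ts, incl (free_vars (F ts)) (flat_map gterm_vars ts)) ->
  In x (free_vars (tauB_atom a F)) -> In x (map Gen (vars_atom a)).
Proof.
  intros HF Hx; apply free_vars_Exs in Hx; destruct Hx as [Hx Hn].
  cbn [free_vars] in Hx; apply in_app_or in Hx; destruct Hx as [Hx|Hx].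
  - apply free_vars_val_tuple in Hx; destruct Hx as [Hx|Hx]; [exact Hx|contradiction].
  - apply HF, in_flat_map in Hx; destruct Hx as (t & Ht & Hx).
    apply in_map_iff in Ht; destruct Ht as (z & <- & Hz).
    destruct Hx as [<-|[]]; destruct Hn; apply in_map, Hz.
Qed.

Lemma free_vars_tauB c x : In x (free_vars (tauB c)) -> In x (map Gen (vars_cond c)).
Proof.
  destruct c as [a|a|a|op t1 t2]; simpl vars_cond.
  - apply free_vars_tauB_atom; intros ts y Hy; exact Hy.
  - apply free_vars_tauB_atom; intros ts y Hy; simpl in Hy; rewrite app_nil_r in Hy; exact Hy.
  - apply free_vars_tauB_atom; intros ts y Hy; simpl in Hy; rewrite !app_nil_r in Hy; exact Hy.
  - intros Hx; apply (free_vars_Exs [_; _]) in Hx; destruct Hx as [Hx Hn].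
    cbn [FConj free_vars gterm_vars] in Hx; rewrite map_app, in_app_iff; simpl in Hn.
    repeat (apply in_app_or in Hx; destruct Hx as [Hx|Hx]);
      try (apply free_vars_val in Hx); simpl in Hx; tauto.
Qed.

Lemma free_vars_tauB_conds L x :
  In x (free_vars (tauB_conds L)) -> In x (map Gen (vars_conds L)).
Proof.
  intros Hx; apply free_vars_Conj in Hx; destruct Hx as (F & HF & Hx).
  apply in_map_iff in HF; destruct HF as (c & <- & Hc); apply free_vars_tauB in Hx.
  apply in_map_iff in Hx; destruct Hx as (y & <- & Hy).
  apply in_map, in_flat_map; eauto.
Qed.

(** * Counting formulas *)

Definition assign (xs : list var) (rs : list precomp) (g : var -> precomp) : var -> precomp :=
  fun y => match tuple_subst xs rs y with Some r => r | None => g y end.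

Lemma tuple_subst_notin xs rs y : ~ In y xs -> tuple_subst xs rs y = None.
Proof.
  revert rs; induction xs as [|x xs IH]; intros [|r rs] Hy; simpl; auto.
  destruct Nat.eq_dec as [->|]; [destruct Hy; left; reflexivity|].
  apply IH; intros H; apply Hy; right; exact H.
Qed.

Lemma tuple_rename_notin xs ys y : ~ In y xs -> tuple_rename xs ys y = y.
Proof.
  revert ys; induction xs as [|x xs IH]; intros [|z ys] Hy; simpl; auto.
  rewrite upd_neq by (intros ->; apply Hy; left; reflexivity).
  apply IH; intros H; apply Hy; right; exact H.
Qed.

Lemma tuple_rename_in xs ys y : length ys = length xs -> In y xs -> In (tuple_rename xs ys y) ys.
Proof.
  revert ys; induction xs as [|x xs IH]; intros [|z ys] Hlen Hy; try discriminate; [destruct Hy|].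
  simpl; unfold upd; destruct Nat.eq_dec as [->|Hn]; [left; reflexivity|right].
  apply IH; [simpl in Hlen; lia|]; destruct Hy; [congruence|assumption].
Qed.

Lemma tuple_subst_rename g xs ys y : length ys = length xs -> In y xs ->
  tuple_subst xs (map g ys) y = Some (g (tuple_rename xs ys y)).
Proof.
  revert ys; induction xs as [|x xs IH]; intros [|z ys] Hlen Hy; try discriminate; [destruct Hy|].
  simpl; unfold upd; destruct Nat.eq_dec as [->|Hn]; [reflexivity|].
  apply IH; [simpl in Hlen; lia|]; destruct Hy; [congruence|assumption].
Qed.

Lemma assign_agree xs g g' : agree_off xs g g' -> assign xs (map g' xs) g = g'.
Proof.
  intros Hg; apply functional_extensionality; intros y; unfold assign.
  destruct (in_dec Nat.eq_dec y xs) as [Hy|Hy].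
  - rewrite tuple_subst_map by exact Hy; reflexivity.
  - rewrite tuple_subst_notin by exact Hy; symmetry; apply Hg, Hy.
Qed.

Lemma agree_off_assign_self xs rs g : agree_off xs g (assign xs rs g).
Proof. intros y Hy; unfold assign; rewrite tuple_subst_notin by exact Hy; reflexivity. Qed.

Lemma map_assign xs rs g : NoDup xs -> length rs = length xs -> map (assign xs rs g) xs = rs.
Proof.
  intros Hnd Hlen; destruct (agree_off_assign g xs rs Hnd Hlen) as (g' & Hg & <-).
  rewrite assign_agree by exact Hg; reflexivity.
Qed.

(** A variable that is really renamed goes to one that occurs nowhere in [F], not even bound, so no
    capture is possible. *)
Lemma fo_forces_rename {P} (v : bool -> P * list precomp -> Prop) F :
  forall w g h s, (forall y, s y = y \/ ~ In (Gen (s y)) (all_vars F)) ->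
  fo_forces v w g h (rename s F) <-> fo_forces v w (fun y => g (s y)) h F.
Proof.
  assert (Et : forall g h s t, gterm_eval g h (rename_gterm s t) =
                               gterm_eval (fun y => g (s y)) h t) by (intros ? ? ? []; reflexivity).
  (* Below a quantifier on [x] the renaming is reset at [x]. It then commutes with updating [x],
     because no other variable is sent to [x]. *)
  assert (Eu : forall (g : var -> precomp) (x : var) r (s : var -> var),
    (forall y, s y = y \/ s y <> x) ->
    (fun y : var => upd g x r (upd s x x y)) = upd (fun y : var => g (s y)) x r).
  { intros g x r s Hs; apply functional_extensionality; intros y; unfold upd at 2 3.
    destruct Nat.eq_dec as [->|Hn]; [apply upd_eq|apply upd_neq].
    destruct (Hs y) as [->|]; assumption. }
  assert (Hu : forall x s G,
    (forall y, s y = y \/ ~ In (Gen (s y)) (Gen x :: all_vars (P := P) G)) ->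
    (forall y, s y = y \/ s y <> x) /\
    (forall y, upd s x x y = y \/ ~ In (Gen (upd s x x y)) (all_vars G))).
  { intros x s G Hs; split; intros y.
    - destruct (Hs y) as [H|H]; [auto|right]; intros E; apply H; left; congruence.
    - unfold upd; destruct Nat.eq_dec as [->|Hn]; [auto|].
      destruct (Hs y) as [H|H]; [auto|right]; intros E; apply H; right; exact E. }
  induction F as [|op t1 t2|p ts|F IHF G IHG|F IHF G IHG|F IHF G IHG|[x|i] F IH|[x|i] F IH];
    intros w g h s Hs; cbn [rename all_vars] in *.
  - reflexivity.
  - rewrite !fo_forces_Cmp, !Et; reflexivity.
  - unfold fo_forces; simpl; rewrite map_map.
    replace (map (fun t => gterm_eval g h (rename_gterm s t)) ts)
      with (map (gterm_eval (fun y => g (s y)) h) ts)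
      by (apply map_ext; intros t; symmetry; apply Et); reflexivity.
  - rewrite !fo_forces_And, IHF, IHG; [reflexivity|..];
      intros y; destruct (Hs y) as [H|H]; auto; right; intros E; apply H, in_or_app; auto.
  - unfold fo_forces in *; simpl ground; rewrite !forces_Or, IHF, IHG; [reflexivity|..];
      intros y; destruct (Hs y) as [H|H]; auto; right; intros E; apply H, in_or_app; auto.
  - apply forces_Impl_iff; intros w'; [apply IHF|apply IHG];
      intros y; destruct (Hs y) as [H|H]; auto; right; intros E; apply H, in_or_app; auto.
  - destruct (Hu x s F Hs) as [Hs1 Hs2].
    split; intros H r; pose proof (IH w (upd g x r) h (upd s x x) Hs2) as E;
      rewrite (Eu g x r s Hs1) in E; apply E, H.
  - split; intros H r; apply (IH w g (upd h i r) s); try apply H;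
      intros y; destruct (Hs y) as [H'|H']; auto; right; intros E; apply H'; right; exact E.
  - destruct (Hu x s F Hs) as [Hs1 Hs2].
    split; intros [r H]; exists r; pose proof (IH w (upd g x r) h (upd s x x) Hs2) as E;
      rewrite (Eu g x r s Hs1) in E; apply E, H.
  - split; intros [r H]; exists r; apply (IH w g (upd h i r) s); try apply H;
      intros y; destruct (Hs y) as [H'|H']; auto; right; intros E; apply H'; right; exact E.
Qed.

Lemma free_vars_all_vars {P} (F : fo P) x : In x (free_vars F) -> In x (all_vars F).
Proof.
  induction F as [| | |F IHF G IHG|F IHF G IHG|F IHF G IHG|y F IH|y F IH]; simpl; auto;
    rewrite ?in_app_iff; try tauto; intros Hx; apply in_remove in Hx; tauto.
Qed.

Lemma concat_map_seq base m n : forall a,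
  concat (map (fun i => seq (base + i * m) m) (seq a n)) = seq (base + a * m) (n * m).
Proof.
  induction n as [|n IH]; intros a; simpl; [reflexivity|].
  rewrite IH, seq_app; f_equal; f_equal; lia.
Qed.

Lemma app_inj_length {T} (l1 l2 k1 k2 : list T) : length l1 = length l2 ->
  l1 ++ k1 = l2 ++ k2 -> l1 = l2 /\ k1 = k2.
Proof.
  revert l2; induction l1 as [|x l1 IH]; intros [|y l2] Hlen E; try discriminate; [auto|].
  injection E as -> E; destruct (IH l2) as [-> ->]; auto.
Qed.

(** Blocks of known length can be read off a concatenation. For [m = 0] the concatenation carries no
    information, and the equal number of blocks settles the matter. *)
Lemma concat_inj_length {T} m (l k : list (list T)) : length l = length k ->
  (forall x, In x l -> length x = m) -> (forall x, In x k -> length x = m) ->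
  concat l = concat k -> l = k.
Proof.
  revert k; induction l as [|x l IH]; intros [|y k] Hlen Hl Hk E; try discriminate; [auto|].
  simpl in E; destruct (app_inj_length _ _ _ _ (eq_trans (Hl x (or_introl eq_refl))
    (eq_sym (Hk y (or_introl eq_refl)))) E) as [-> E'].
  f_equal; apply IH; auto; simpl in *; auto.
Qed.

Lemma pairs_in {T} (l : list T) p : In p (pairs l) -> In (fst p) l /\ In (snd p) l.
Proof.
  induction l as [|x l IH]; simpl; [intros []|].
  intros Hp; apply in_app_or in Hp; destruct Hp as [Hp|Hp]; [|tauto].
  apply in_map_iff in Hp; destruct Hp as (y & <- & Hy); simpl; auto.
Qed.

Lemma NoDup_map_pairs {T U} (f : T -> U) l :
  NoDup (map f l) <-> forall p, In p (pairs l) -> f (fst p) <> f (snd p).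
Proof.
  induction l as [|x l IH]; simpl; [split; [intros _ p []|constructor]|].
  rewrite NoDup_cons_iff, IH; split.
  - intros [Hx Hl] p Hp; apply in_app_or in Hp; destruct Hp as [Hp|Hp]; [|auto].
    apply in_map_iff in Hp; destruct Hp as (y & <- & Hy); simpl; intros E.
    apply Hx; rewrite E; apply in_map, Hy.
  - intros H; split.
    + intros Hx; apply in_map_iff in Hx; destruct Hx as (y & E & Hy).
      apply (H (x, y)); [apply in_or_app; left; apply in_map, Hy|symmetry; exact E].
    + intros p Hp; apply H, in_or_app; auto.
Qed.

(** * Copies of a formula on fresh tuples of variables *)

Section Copies.

Context (v : bool -> patom -> Prop) (g : var -> precomp) (h : nat -> Z).
Context (X : list var) (F : fo0) (n : nat).

Let Xs := fresh_tuples n X F.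

Definition satisfying (w : bool) (xs : list precomp) : Prop :=
  fo_forces v w (assign X xs g) h F.

Lemma fresh_tuples_length : length Xs = n.
Proof. unfold Xs, fresh_tuples; rewrite length_map, length_seq; reflexivity. Qed.

Lemma fresh_tuples_in Xi : In Xi Xs -> length Xi = length X.
Proof.
  intros H; apply in_map_iff in H; destruct H as (i & <- & _); apply length_seq.
Qed.

Lemma fresh_tuples_concat :
  concat Xs = seq (fresh (X ++ general_vars (all_vars F))) (n * length X).
Proof. unfold Xs, fresh_tuples; rewrite concat_map_seq; f_equal; lia. Qed.

Lemma fresh_tuples_notin y : In y (concat Xs) -> ~ In y X /\ ~ In (Gen y) (all_vars F).
Proof.
  rewrite fresh_tuples_concat; intros Hy.
  assert (Hn : ~ In y (X ++ general_vars (all_vars F)))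
    by (intros H; apply (not_in_seq_fresh _ _ _ H Hy)).
  split; intros H; apply Hn, in_or_app; [auto|right].
  apply in_flat_map; exists (Gen y); simpl; auto.
Qed.

(** The fresh tuples are consecutive blocks of distinct variables, so all of them receive their
    values at once from [concat Delta]. *)
Lemma fresh_tuples_assign Delta : finite_tuple_set (length X) Delta -> length Delta = n ->
  exists g', agree_off (concat Xs) g g' /\ map (map g') Xs = Delta.
Proof.
  intros [_ HD] Hn.
  assert (HnX : length (map (fun _ => tt) Xs) = length Delta)
    by (rewrite length_map, fresh_tuples_length; auto).
  destruct (agree_off_assign g (concat Xs) (concat Delta)) as (g' & Hg & Hm).
  - rewrite fresh_tuples_concat; apply seq_NoDup.
  - rewrite fresh_tuples_concat, length_seq, <- Hn.
    clear Hn HnX; induction Delta as [|x Delta IH]; [reflexivity|].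
    simpl; rewrite length_app, IH, (HD x (or_introl eq_refl)); [reflexivity|].
    intros y Hy; apply HD; right; exact Hy.
  - exists g'; split; [exact Hg|].
    apply (concat_inj_length (length X)).
    + rewrite length_map, fresh_tuples_length; auto.
    + intros x Hx; apply in_map_iff in Hx; destruct Hx as (Xi & <- & HXi).
      rewrite length_map; apply fresh_tuples_in, HXi.
    + exact HD.
    + rewrite <- Hm, concat_map; reflexivity.
Qed.

(** Evaluating the copy on [Xi] under [g'] amounts to evaluating [F] with [X] assigned the values of
    [Xi]; the parameters of [F] are not among the fresh variables and keep their values from [g]. *)
Lemma fo_forces_copies w g' : agree_off (concat Xs) g g' ->
  (forall G, In G (copies Xs X F) -> fo_forces v w g' h G) <->
  (forall xs, In xs (map (map g') Xs) -> satisfying w xs).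
Proof.
  intros Hg.
  assert (E : forall Xi, In Xi Xs ->
    fo_forces v w g' h (rename (tuple_rename X Xi) F) <-> satisfying w (map g' Xi)).
  { intros Xi HXi; pose proof (fresh_tuples_in Xi HXi) as Hlen.
    rewrite fo_forces_rename.
    - apply fo_forces_ext; [|reflexivity]; intros y Hy; unfold assign.
      destruct (in_dec Nat.eq_dec y X) as [HyX|HyX].
      + rewrite tuple_subst_rename by assumption; reflexivity.
      + rewrite tuple_subst_notin, tuple_rename_notin by assumption.
        apply Hg; intros Hc; apply fresh_tuples_notin in Hc.
        apply Hc, free_vars_all_vars, Hy.
    - intros y; destruct (in_dec Nat.eq_dec y X) as [HyX|HyX].
      + right; apply fresh_tuples_notin, in_concat; exists Xi; split; [exact HXi|].
        apply tuple_rename_in; assumption.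
      + left; apply tuple_rename_notin, HyX. }
  split.
  - intros H xs Hxs; apply in_map_iff in Hxs; destruct Hxs as (Xi & <- & HXi).
    apply E; [exact HXi|]; apply H.
    exact (in_map (fun Xi => rename (tuple_rename X Xi) F) _ _ HXi).
  - intros H G HG; apply in_map_iff in HG; destruct HG as (Xi & <- & HXi).
    apply E; [exact HXi|]; apply H, in_map, HXi.
Qed.

Lemma fo_forces_tuple_eq w g' Xi Xj : length Xi = length Xj ->
  fo_forces v w g' h (tuple_eq Xi Xj) <-> map g' Xi = map g' Xj.
Proof.
  intros Hlen; unfold tuple_eq; rewrite fo_forces_Conj.
  revert Xj Hlen; induction Xi as [|x Xi IH]; intros [|y Xj] Hlen; try discriminate; simpl.
  - split; [reflexivity|intros _ G []].
  - specialize (IH Xj); split.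
    + intros H; f_equal; [|apply IH; [simpl in Hlen; lia|auto]].
      apply (fo_forces_Cmp v w g' h CEq (GVar x) (GVar y)); auto.
    + intros E G [<-|HG]; injection E as E1 E2.
      * apply fo_forces_Cmp; exact E1.
      * apply IH; [simpl in Hlen; lia|exact E2|exact HG].
Qed.

Lemma fo_forces_pairs w g' XY : In XY (pairs Xs) ->
  fo_forces v w g' h (tuple_eq (fst XY) (snd XY)) <-> map g' (fst XY) = map g' (snd XY).
Proof.
  intros H; apply pairs_in in H; apply fo_forces_tuple_eq.
  transitivity (length X); [|symmetry]; apply fresh_tuples_in, H.
Qed.

Lemma fresh_tuples_set g' :
  NoDup (map (map g') Xs) -> finite_tuple_set (length X) (map (map g') Xs).
Proof.
  intros H; split; [exact H|]; intros xs Hxs; apply in_map_iff in Hxs.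
  destruct Hxs as (Xi & <- & HXi); rewrite length_map; apply fresh_tuples_in, HXi.
Qed.

(** Equalities do not depend on the world, so their negations say just that the list of chosen
    values has no repetitions, that is, forms a set of exactly [n] tuples. *)
Lemma fo_forces_atleast w :
  fo_forces v w g h
    (FExs (map Gen (concat Xs))
       (FConj (copies Xs X F ++ map (fun XY => FNeg (tuple_eq (fst XY) (snd XY))) (pairs Xs)))) <->
  exists Delta, finite_tuple_set (length X) Delta /\ length Delta = n /\
    forall xs, In xs Delta -> satisfying w xs.
Proof.
  assert (E : forall g', agree_off (concat Xs) g g' ->
    fo_forces v w g' h
      (FConj (copies Xs X F ++ map (fun XY => FNeg (tuple_eq (fst XY) (snd XY))) (pairs Xs))) <->
    (forall xs, In xs (map (map g') Xs) -> satisfying w xs) /\ NoDup (map (map g') Xs)).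
  { intros g' Hg; rewrite <- fo_forces_copies, fo_forces_Conj, NoDup_map_pairs by exact Hg.
    split.
    - intros H; split; [intros G HG; apply H, in_or_app; auto|].
      intros XY HXY Heq.
      assert (HN : fo_forces v w g' h (FNeg (tuple_eq (fst XY) (snd XY)))).
      { apply H, in_or_app; right.
        exact (in_map (fun XY => FNeg (tuple_eq (fst XY) (snd XY))) _ _ HXY). }
      rewrite fo_forces_Neg in HN; apply (HN w); [auto|].
      apply fo_forces_pairs; assumption.
    - intros [H1 H2] G HG; apply in_app_or in HG; destruct HG as [HG|HG]; [auto|].
      apply in_map_iff in HG; destruct HG as (XY & <- & HXY).
      apply fo_forces_Neg; intros w' _ Heq; apply (H2 XY HXY).
      apply (fo_forces_pairs w' g' XY HXY), Heq. }
  rewrite fo_forces_Exs; split.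
  - intros (g' & Hg & H); apply E in H; [|exact Hg]; exists (map (map g') Xs).
    split; [apply fresh_tuples_set, H|].
    split; [rewrite length_map; apply fresh_tuples_length|apply H].
  - intros (Delta & HD & Hn & HS).
    destruct (fresh_tuples_assign Delta HD Hn) as (g' & Hg & Hm).
    exists g'; split; [exact Hg|]; apply E; [exact Hg|]; rewrite Hm; split; [exact HS|apply HD].
Qed.

(** The disjunction of equalities is world-independent and fails exactly on distinct tuples. Hence
    the implication acts as a negation: at no accessible world do [n] distinct tuples all satisfy
    [F]. *)
Lemma fo_forces_atmost w :
  fo_forces v w g h
    (FAlls (map Gen (concat Xs))
       (FImp (FConj (copies Xs X F))
             (FDisj (map (fun XY => tuple_eq (fst XY) (snd XY)) (pairs Xs))))) <->
  forall Delta, finite_tuple_set (length X) Delta -> length Delta = n ->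
    forall w', accessible w w' -> ~ forall xs, In xs Delta -> satisfying w' xs.
Proof.
  rewrite fo_forces_Alls_Gen; split.
  - intros H Delta HD Hn w' Hw HS.
    destruct (fresh_tuples_assign Delta HD Hn) as (g' & Hg & Hm).
    specialize (H g' Hg w' Hw); cbv beta in H.
    assert (HC : fo_forces v w' g' h (FConj (copies Xs X F))).
    { apply fo_forces_Conj, fo_forces_copies; [exact Hg|]; rewrite Hm; exact HS. }
    apply H, fo_forces_Disj in HC; destruct HC as (G & HG & Heq).
    apply in_map_iff in HG; destruct HG as (XY & <- & HXY).
    apply (fo_forces_pairs w' g' XY HXY) in Heq.
    destruct HD as [HD _]; rewrite <- Hm in HD.
    exact (proj1 (NoDup_map_pairs (map g') Xs) HD XY HXY Heq).
  - intros H g' Hg; apply fo_forces_Imp; intros w' Hw HC.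
    rewrite fo_forces_Conj, fo_forces_copies in HC by exact Hg.
    apply fo_forces_Disj; apply NNPP; intros Hn.
    apply (H (map (map g') Xs)) with (w' := w'); [|rewrite length_map; apply fresh_tuples_length
      |exact Hw|exact HC].
    apply fresh_tuples_set, NoDup_map_pairs; intros XY HXY Heq; apply Hn.
    exists (tuple_eq (fst XY) (snd XY)); split;
      [exact (in_map (fun XY => tuple_eq (fst XY) (snd XY)) _ _ HXY)|].
    apply fo_forces_pairs; assumption.
Qed.

End Copies.

(** * Bounds on cardinality expressed by finite sets *)

(** The common meaning of an aggregate atom and of its counting formula, with [S] standing for
    satisfaction of the element. The clause for [BLe] inspects all accessible worlds because it
    comes from a negation. *)
Definition counts (b : bound) (m : nat) (c : precomp) (S : bool -> list precomp -> Prop)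
  (w : bool) : Prop :=
  match b with
  | BGe => exists Delta,
      (finite_tuple_set m Delta /\ cmp_holds le CGe (Num (Z.of_nat (length Delta))) c) /\
      forall xs, In xs Delta -> S w xs
  | BLe => forall Delta,
      finite_tuple_set m Delta /\ cmp_holds le CGt (Num (Z.of_nat (length Delta))) c ->
      forall w', accessible w w' -> ~ forall xs, In xs Delta -> S w' xs
  end.

Lemma counts_ext b m c S S' w :
  (forall w xs, length xs = m -> S w xs <-> S' w xs) -> counts b m c S w <-> counts b m c S' w.
Proof.
  intros H.
  assert (E : forall Delta w', finite_tuple_set m Delta ->
    (forall xs, In xs Delta -> S w' xs) <-> (forall xs, In xs Delta -> S' w' xs)).
  { intros Delta w' [_ HD]; split; intros HS xs Hxs; apply (H w' xs (HD xs Hxs)), HS, Hxs. }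
  destruct b; simpl; split.
  - intros (Delta & HD & HS); exists Delta; split; [exact HD|]; apply (E _ _ (proj1 HD)), HS.
  - intros (Delta & HD & HS); exists Delta; split; [exact HD|]; apply (E _ _ (proj1 HD)), HS.
  - intros HS Delta HD w' Hw H'; apply (HS Delta HD w' Hw), (E _ _ (proj1 HD)), H'.
  - intros HS Delta HD w' Hw H'; apply (HS Delta HD w' Hw), (E _ _ (proj1 HD)), H'.
Qed.

Lemma NoDup_firstn {T} n (l : list T) : NoDup l -> NoDup (firstn n l).
Proof.
  intros H; rewrite <- (firstn_skipn n l) in H; exact (NoDup_app_remove_r _ _ H).
Qed.

Lemma in_firstn {T} n (l : list T) x : In x (firstn n l) -> In x l.
Proof. intros H; rewrite <- (firstn_skipn n l); apply in_or_app; auto. Qed.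

Lemma finite_tuple_set_firstn n m Delta :
  finite_tuple_set m Delta -> finite_tuple_set m (firstn n Delta).
Proof.
  intros [H1 H2]; split; [apply NoDup_firstn, H1|].
  intros xs Hxs; apply H2, (in_firstn n), Hxs.
Qed.

Lemma finite_tuple_set_nil m : finite_tuple_set m [].
Proof. split; [constructor|intros xs []]. Qed.

(** By contiguity only numerals lie between zero and a numeral. This isolates the bounds that a
    finite cardinality can reach. *)
Lemma le_Num_cases (r : precomp) (n : nat) : le r (Num (Z.of_nat n)) ->
  le r (Num 0) \/ exists p, r = Num (Zpos p).
Proof.
  intros Hn; destruct (po_total le Hle r (Num 0)) as [H|H]; [auto|].
  destruct (po_contiguous le Hle _ _ _ H Hn) as (k & ->).
  destruct k as [|p|p]; [left; exact H|right; exists p; reflexivity|].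
  left; apply po_num; [exact Hle|lia].
Qed.

Definition exists_bound (b : bound) : precomp -> list var -> fo0 -> fo0 :=
  match b with BGe => exists_atleast le | BLe => exists_atmost le end.

Lemma fo_forces_exists_atleast v w g h r X F :
  fo_forces v w g h (exists_atleast le r X F) <->
  counts BGe (length X) r (satisfying v g h X F) w.
Proof.
  assert (Hother : (forall p, r <> Num (Zpos p)) ->
    fo_forces v w g h (if excluded_middle_informative (cmp_holds le CLe r (Num 0))
                       then FTop else FBot) <->
    counts BGe (length X) r (satisfying v g h X F) w).
  { intros Hr; destruct excluded_middle_informative as [H|H]; split.
    (* The empty set already reaches a bound that is at most zero. *)
    - intros _; exists []; split; [split; [apply finite_tuple_set_nil|exact H]|intros xs []].
    - intros _; apply fo_forces_Top.
    - intros HB; destruct (fo_forces_Bot _ _ _ _ HB).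
    - intros (Delta & [_ HD] & _); destruct (le_Num_cases _ _ HD) as [H'|[p H']];
        [contradiction|destruct (Hr p H')]. }
  destruct r as [[|p|p]|c| |]; try (apply Hother; discriminate).
  unfold exists_atleast; rewrite fo_forces_atleast; simpl counts; split.
  - intros (Delta & HD & Hn & HS); exists Delta; split; [split; [exact HD|]|exact HS].
    apply po_num; [exact Hle|lia].
  - intros (Delta & [HD Hc] & HS); apply po_num in Hc; [|exact Hle].
    (* A larger set is cut down to the exact number of tuples in the formula. *)
    exists (firstn (Pos.to_nat p) Delta); split; [apply finite_tuple_set_firstn, HD|].
    split; [apply firstn_length_le; lia|].
    intros xs Hxs; apply HS, (in_firstn (Pos.to_nat p)), Hxs.
Qed.

Lemma fo_forces_exists_atmost v w g h r X F :
  fo_forces v w g h (exists_atmost le r X F) <->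
  counts BLe (length X) r (satisfying v g h X F) w.
Proof.
  assert (Hbounded : forall n, r = Num (Z.of_nat n) ->
    (forall Delta, finite_tuple_set (length X) Delta -> length Delta = S n ->
       forall w', accessible w w' -> ~ forall xs, In xs Delta -> satisfying v g h X F w' xs) <->
    counts BLe (length X) r (satisfying v g h X F) w).
  { intros n ->; simpl; split.
    - intros H Delta [HD [Hle' Hne]] w' Hw HS; apply po_num in Hle'; [|exact Hle].
      (* A set with more than [n] members contains one with exactly [S n], the number of tuples in
         the formula. *)
      apply (H (firstn (S n) Delta)) with (w' := w').
      + apply finite_tuple_set_firstn, HD.
      + apply firstn_length_le; destruct (Nat.eq_dec (length Delta) n); [|lia].
        subst n; destruct Hne; reflexivity.
      + exact Hw.
      + intros xs Hxs; apply HS, (in_firstn (S n)), Hxs.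
    - intros H Delta HD Hn; apply H; split; [exact HD|]; rewrite Hn; split.
      + apply po_num; [exact Hle|lia].
      + intros E; injection E; lia. }
  assert (Hother : (forall n, r <> Num (Z.of_nat n)) ->
    fo_forces v w g h (if excluded_middle_informative (cmp_holds le CLt r (Num 0))
                       then FBot else FTop) <->
    counts BLe (length X) r (satisfying v g h X F) w).
  { intros Hr; destruct excluded_middle_informative as [H|H]; split.
    - intros HB; destruct (fo_forces_Bot _ _ _ _ HB).
    (* A bound below zero is exceeded even by the empty set, whose members satisfy anything. *)
    - intros HC; exfalso; apply (HC []) with (w' := w);
        [|apply accessible_refl|intros xs []].
      split; [apply finite_tuple_set_nil|]; split; [apply H|].
      intros E; apply (Hr 0); symmetry; exact E.
    - intros _ Delta [_ [HD _]]; exfalso; destruct (le_Num_cases _ _ HD) as [H'|[p H']].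
      + apply H; split; [exact H'|exact (Hr 0)].
      + apply (Hr (Pos.to_nat p)); rewrite H', positive_nat_Z; reflexivity.
    - intros _; apply fo_forces_Top. }
  destruct r as [[|p|p]|c| |]; try (apply Hother; intros n; try discriminate).
  - unfold exists_atmost; rewrite fo_forces_atmost; apply Hbounded; reflexivity.
  - unfold exists_atmost; rewrite fo_forces_atmost; apply Hbounded.
    rewrite positive_nat_Z; reflexivity.
  - intros E; injection E; lia.
Qed.

Lemma fo_forces_exists_bound v w g h b r X F :
  fo_forces v w g h (exists_bound b r X F) <->
  counts b (length X) r (satisfying v g h X F) w.
Proof. destruct b; [apply fo_forces_exists_atleast|apply fo_forces_exists_atmost]. Qed.

Lemma satisfying_ext v w g g' h h' X V F xs : count_pred_ok X V F ->
  length xs = length X -> (forall x, In x V -> g x = g' x) ->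
  satisfying v g h X F w xs <-> satisfying v g' h' X F w xs.
Proof.
  intros (Hnd & _ & _ & Hfree) Hlen Hg; apply fo_forces_ext.
  - intros x Hx; apply Hfree, in_map_iff in Hx; destruct Hx as (y & E & Hy).
    injection E as ->; apply in_app_or in Hy.
    destruct (in_dec Nat.eq_dec x X) as [HxX|HxX].
    + pose proof (map_assign X xs g Hnd Hlen) as E.
      rewrite <- (map_assign X xs g' Hnd Hlen) in E at 2.
      exact (ext_in_map E x HxX).
    + rewrite !agree_off_assign_self by exact HxX; apply Hg; tauto.
  - intros i Hi; apply Hfree, in_map_iff in Hi; destruct Hi as (y & E & _); discriminate.
Qed.

(** * Rules and programs *)

Definition plain (v : bool -> pred1 * list precomp -> Prop) : bool -> patom -> Prop :=
  fun w a => v w (Plain (fst a), snd a).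

Lemma fo_forces_lift v F : forall w g h,
  fo_forces v w g h (lift F) <-> fo_forces (plain v) w g h F.
Proof.
  unfold fo_forces.
  induction F as [|op t1 t2|p ts|F IHF G IHG|F IHF G IHG|F IHF G IHG|[x|i] F IH|[x|i] F IH];
    intros w g h; simpl lift; simpl ground.
  - rewrite !forces_Bot; reflexivity.
  - rewrite !forces_truth; reflexivity.
  - reflexivity.
  - rewrite !forces_And, IHF, IHG; reflexivity.
  - rewrite !forces_Or, IHF, IHG; reflexivity.
  - split; intros H w' Hw HF; apply IHG, H; try apply IHF; assumption.
  - split; intros H r; apply IH, H.
  - split; intros H r; apply IH, H.
  - split; intros [r H]; exists r; apply IH, H.
  - split; intros [r H]; exists r; apply IH, H.
Qed.

Lemma forces_tau_count (v : bool -> patom -> Prop) w b X L t : length (values t) <= 1 ->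
  forces v w (tau_count le b X L t) <->
  exists c, In c (values t) /\
    counts b (length X) c
      (fun w' xs => exists ws, length ws = length (vars_outside L X) /\
         forces v w' (tau_conds le
           (map (subst_cond (tuple_subst (X ++ vars_outside L X) (xs ++ ws))) L))) w.
Proof.
  intros Hlen; unfold tau_count; destruct (values t) as [|c [|]]; simpl in Hlen; [|clear Hlen|lia].
  - rewrite forces_Bot; split; [intros []|intros (c & [] & _)].
  - set (S := fun w' xs => exists ws, _).
    assert (E : forall w' Delta, forces v w' (tau_all_satisfy le X L Delta) <->
                              forall xs, In xs Delta -> S w' xs).
    { intros w' Delta; unfold tau_all_satisfy; rewrite forces_ConjOver.
      split; intros H xs Hxs; [apply forces_DisjOver, H, Hxs|].
      apply forces_DisjOver; exact (H xs Hxs). }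
    transitivity (counts b (length X) c S w);
      [|split; [intros H; exists c; simpl; auto|intros (c' & [<-|[]] & H); exact H]].
    destruct b; cbn [counts].
    + rewrite forces_DisjOver; split; intros (Delta & HD & H); exists Delta;
        (split; [exact HD|apply E, H]).
    + rewrite forces_ConjOver; split; intros H Delta HD.
      * specialize (H Delta HD); rewrite forces_Neg in H.
        intros w' Hw HS; apply (H w' Hw), E, HS.
      * apply forces_Neg; intros w' Hw HS; apply (H Delta HD w' Hw), E, HS.
Qed.

(* The integer assignment is irrelevant since [F] has no free integer variables. *)
Definition Defs_model (v : bool -> pred1 * list precomp -> Prop) : Prop :=
  forall b X V F r, count_pred_ok X V F -> forall w g,
    v w (count_pred b X V F, map g V ++ [r]) <->
    counts b (length X) r (satisfying (plain v) g (fun _ => 0%Z) X F) w.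

Lemma Defs_model_iff v : monotone v ->
  (forall K, gr_Defs le K -> forces v false K) <-> Defs_model v.
Proof.
  intros Hv.
  assert (E : forall b X V F r,
    forces v false (gr le (FAlls (map Gen V)
      (FIff (FPred (count_pred b X V F) (map GVar V ++ [gpre r]))
            (lift (exists_bound b r X F))))) <->
    forall g, agree_off V (fun _ => Inf) g -> forall w,
      v w (count_pred b X V F, map g V ++ [r]) <->
      counts b (length X) r (satisfying (plain v) g (fun _ => 0%Z) X F) w).
  { intros b X V F r.
    assert (E : forall w g,
      (fo_forces v w g (fun _ => 0%Z) (FPred (count_pred b X V F) (map GVar V ++ [gpre r])) <->
       v w (count_pred b X V F, map g V ++ [r])) /\
      (fo_forces v w g (fun _ => 0%Z) (lift (exists_bound b r X F)) <->
       counts b (length X) r (satisfying (plain v) g (fun _ => 0%Z) X F) w)).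
    { intros w g; split; [|rewrite fo_forces_lift; apply fo_forces_exists_bound].
      unfold fo_forces; simpl; rewrite map_app, map_map; simpl.
      replace (gterm_eval g (fun _ => 0%Z) (gpre r)) with r by (destruct r; reflexivity).
      reflexivity. }
    unfold gr; etransitivity; [apply fo_forces_Alls_Gen|].
    split; intros H g Hg.
    - intros w; specialize (H g Hg).
      apply (proj1 (forces_Iff v false _ _)) with (w' := w) in H; [|discriminate].
      destruct (E w g) as [E1 E2]; rewrite <- E1, <- E2; exact H.
    - apply (proj2 (forces_Iff v false _ _)); intros w _.
      destruct (E w g) as [E1 E2]; etransitivity; [exact E1|].
      etransitivity; [apply H, Hg|symmetry; exact E2]. }
  split.
  - intros H b X V F r Hok w g.
    assert (HD : gr_Defs le (gr le (FAlls (map Gen V)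
      (FIff (FPred (count_pred b X V F) (map GVar V ++ [gpre r]))
            (lift (exists_bound b r X F)))))).
    { destruct b; (eexists; split; [|reflexivity]); [apply Defs_atleast|apply Defs_atmost];
        exact Hok. }
    set (g' := assign V (map g V) (fun _ => Inf)).
    assert (Hg' : map g' V = map g V).
    { apply map_assign; [apply Hok|apply length_map]. }
    rewrite <- Hg', (proj1 (E b X V F r) (H _ HD) g' (agree_off_assign_self _ _ _)).
    apply counts_ext; intros w' xs Hxs; apply (satisfying_ext _ _ _ _ _ _ X V); auto.
    intros x Hx; exact (ext_in_map Hg' x Hx).
  - intros H K (F0 & HF & ->); destruct HF as [X V F r Hok|X V F r Hok].
    + apply (E BGe); intros g _ w; apply (H BGe); exact Hok.
    + apply (E BLe); intros g _ w; apply (H BLe); exact Hok.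
Qed.

Section Rules.

Context (v : bool -> pred1 * list precomp -> Prop) (Hdefs : Defs_model v).

Definition global_subst (globals : list var) (g : var -> precomp) : subst :=
  fun x => if in_dec Nat.eq_dec x globals then Some (g x) else None.

Lemma global_subst_in globals g x : In x globals -> global_subst globals g x = Some (g x).
Proof. intros Hx; unfold global_subst; destruct in_dec; [reflexivity|contradiction]. Qed.

Lemma global_subst_notin globals g x : ~ In x globals -> global_subst globals g x = None.
Proof. intros Hx; unfold global_subst; destruct in_dec; [contradiction|reflexivity]. Qed.

Lemma global_subst_None globals g x : global_subst globals g x = None <-> ~ In x globals.
Proof. unfold global_subst; destruct in_dec; split; (discriminate || contradiction || auto). Qed.

Lemma vars_outside_in L X x : In x (vars_outside L X) <-> In x (vars_conds L) /\ ~ In x X.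
Proof.
  unfold vars_outside; rewrite filter_In, nodup_In.
  destruct (in_dec Nat.eq_dec x X); intuition discriminate.
Qed.

Lemma vars_outside_NoDup L X : NoDup (vars_outside L X).
Proof. apply NoDup_filter, NoDup_nodup. Qed.

(** * Aggregate atoms *)

Section Count.

Context (globals X : list var) (L : list cond) (g : var -> precomp).
Hypothesis HX : NoDup X.
Hypothesis HXg : forall x, In x X -> ~ In x globals.

Let is_global x := if in_dec Nat.eq_dec x globals then true else false.
Let V := filter is_global (nodup Nat.eq_dec (vars_conds L)).
Let W := filter (fun x => negb (is_global x)) (vars_outside L X).
Let F := FExs (map Gen W) (tauB_conds L).
Let L' := map (subst_cond (global_subst globals g)) L.
Let W' := vars_outside L' X.

Lemma is_global_iff x : is_global x = true <-> In x globals.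
Proof. unfold is_global; destruct in_dec; intuition discriminate. Qed.

Lemma element_locals_in x : In x W <-> In x (vars_conds L) /\ ~ In x X /\ ~ In x globals.
Proof.
  unfold W; rewrite filter_In, vars_outside_in, <- (is_global_iff x).
  destruct (is_global x); intuition discriminate.
Qed.

(** [tau] collects the local variables from the instance, [tau_star] from the rule. Agreement of
    members is enough, as a block of quantifiers does not depend on the order of its variables. *)
Lemma instance_locals_in x : In x W' <-> In x W.
Proof.
  unfold W', L'; rewrite vars_outside_in, vars_subst_conds, global_subst_None, element_locals_in.
  tauto.
Qed.

Lemma element_globals_in x : In x V <-> In x (vars_conds L) /\ In x globals.
Proof. unfold V; rewrite filter_In, nodup_In, is_global_iff; reflexivity. Qed.

(** Purity makes [X] and [V] disjoint, and a variable of [L] outside both is bound by the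
    quantifiers over [W]. *)
Lemma count_pred_ok_element : count_pred_ok X V F.
Proof.
  split; [exact HX|split; [apply NoDup_filter, NoDup_nodup|split]].
  - intros x Hx HV; apply element_globals_in in HV; exact (HXg x Hx (proj2 HV)).
  - intros y Hy; apply free_vars_Exs in Hy; destruct Hy as [Hy HW].
    apply free_vars_tauB_conds, in_map_iff in Hy; destruct Hy as (x & <- & Hx).
    apply in_map, in_or_app.
    destruct (in_dec Nat.eq_dec x X) as [HxX|HxX]; [auto|right].
    apply element_globals_in; split; [exact Hx|].
    apply NNPP; intros Hg; apply HW, in_map, element_locals_in; auto.
Qed.

(** Every variable of [L] is global, a member of [X] or another local one, so instantiating the rule
    and afterwards substituting for [X] and [W'] amounts to the single assignment [g']. *)
Lemma subst_element g' : (forall x, In x (vars_conds L) -> In x globals -> g' x = g x) ->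
  map (subst_cond (tuple_subst (X ++ W') (map g' (X ++ W')))) L' =
  map (subst_cond (ground_subst g')) L.
Proof.
  intros Hg; unfold L'; rewrite map_map; apply map_ext_in; intros c Hc.
  rewrite subst_cond_comp; apply subst_cond_ext; intros x Hx.
  assert (HxL : In x (vars_conds L)) by (apply in_flat_map; eauto).
  unfold subst_comp; destruct (in_dec Nat.eq_dec x globals) as [Hxg|Hxg].
  - rewrite global_subst_in by exact Hxg; unfold ground_subst; f_equal; symmetry; auto.
  - rewrite global_subst_notin, tuple_subst_map; [reflexivity| |exact Hxg].
    apply in_or_app; destruct (in_dec Nat.eq_dec x X); [auto|right].
    apply instance_locals_in, element_locals_in; auto.
Qed.

(** Assignments to the quantified variables and tuples [ws] correspond to each other by taking
    values on [W']; neither [X] nor [W] contains a global variable, so the instance is not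
    affected. *)
Lemma satisfying_element (u : bool -> patom -> Prop) w h xs : length xs = length X ->
  satisfying u g h X F w xs <->
  exists ws, length ws = length W' /\
    forces u w (tau_conds le (map (subst_cond (tuple_subst (X ++ W') (xs ++ ws))) L')).
Proof.
  intros Hlen; unfold satisfying, F; rewrite fo_forces_Exs; set (g1 := assign X xs g).
  assert (HXW : forall g', agree_off W g1 g' -> map g' X = xs).
  { intros g' Hg'; rewrite <- (map_assign X xs g HX Hlen); apply map_ext_in.
    intros x Hx; apply Hg'; intros HxW; apply element_locals_in in HxW; tauto. }
  assert (Hglob : forall g', agree_off W g1 g' -> forall x, In x globals -> g' x = g x).
  { intros g' Hg' x Hx; rewrite Hg' by (rewrite element_locals_in; tauto).
    apply agree_off_assign_self; intros HxX; exact (HXg x HxX Hx). }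
  split.
  - intros (g' & Hg' & H); exists (map g' W'); split; [apply length_map|].
    rewrite <- (HXW g' Hg'), <- map_app, subst_element by eauto.
    apply fo_forces_tauB_conds in H; exact H.
  - intros (ws & Hws & H).
    destruct (agree_off_assign g1 W' ws (vars_outside_NoDup _ _) Hws) as (g' & Hg' & Hm).
    assert (HgW : agree_off W g1 g')
      by (intros x Hx; apply Hg'; rewrite instance_locals_in; exact Hx).
    exists g'; split; [exact HgW|]; apply fo_forces_tauB_conds.
    rewrite <- (HXW g' HgW), <- Hm, <- map_app, subst_element in H by eauto; exact H.
Qed.

(** [Hdefs] turns the counting atom into its cardinality condition. The variable [C] is fresh for
    [t] and [V], so its value affects neither the values of [t] nor the other arguments. *)
Lemma fo_forces_count b t w h : interval_free t -> incl (vars_term t) globals ->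
  fo_forces v w g h (tau_star_body_elem globals (Count b X L t)) <->
  forces (plain v) w (tau_count le b X L' (subst_term (global_subst globals g) t)).
Proof.
  intros Ht Hvt.
  rewrite forces_tau_count by (apply interval_free_values, interval_free_subst, Ht).
  set (C := fresh (vars_term t ++ V)).
  assert (HC : forall r, agree_off [C] g (upd g C r)).
  { intros r x Hx; apply upd_neq; intros ->; apply Hx; left; reflexivity. }
  assert (HCt : ~ In C (vars_term t ++ V)).
  { intros H; exact (Nat.lt_irrefl _ (lt_fresh C _ H)). }
  assert (E : forall r, fo_forces v w (upd g C r) h
      (FAnd (val 0 t (GVar C)) (FPred (count_pred b X V F) (map GVar (V ++ [C])))) <->
    In r (values (subst_term (global_subst globals g) t)) /\
    counts b (length X) r
      (fun w' xs => exists ws, length ws = length W' /\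
         forces (plain v) w' (tau_conds le
           (map (subst_cond (tuple_subst (X ++ W') (xs ++ ws))) L'))) w).
  { intros r; rewrite fo_forces_And, fo_forces_val by (intros i [E|[]]; discriminate).
    unfold ground_values; simpl gterm_eval; rewrite upd_eq.
    rewrite (subst_term_ext (ground_subst (upd g C r)) (global_subst globals g) t).
    2:{ intros x Hx; rewrite global_subst_in by (apply Hvt, Hx); unfold ground_subst; f_equal.
        apply HC; intros [<-|[]]; apply HCt, in_or_app; auto. }
    apply and_iff_compat_l; unfold fo_forces; simpl.
    rewrite map_map, map_app; simpl; rewrite upd_eq.
    transitivity (v w (count_pred b X V F, map (upd g C r) V ++ [r])); [reflexivity|].
    rewrite (map_ext_in (upd g C r) g V).
    2:{ intros x Hx; apply HC; intros [<-|[]]; apply HCt, in_or_app; auto. }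
    etransitivity; [apply (Hdefs b X V F r count_pred_ok_element w g)|].
    apply counts_ext; intros w' xs Hxs; apply satisfying_element, Hxs. }
  split; intros (r & H); exists r; apply E, H.
Qed.

End Count.

Lemma subst_atom_global globals g a : incl (vars_atom a) globals ->
  subst_atom (global_subst globals g) a = subst_atom (ground_subst g) a.
Proof. intros Ha; apply subst_atom_ext; intros x Hx; apply global_subst_in, Ha, Hx. Qed.

Lemma subst_cond_global globals g c : incl (vars_cond c) globals ->
  subst_cond (global_subst globals g) c = subst_cond (ground_subst g) c.
Proof. intros Ha; apply subst_cond_ext; intros x Hx; apply global_subst_in, Ha, Hx. Qed.

(** * Single rules and their instances *)

Section OneRule.

Context (R : rule) (Hwf : well_formed_rule R) (Hpure : pure R).

Let instance g : rule := subst_rule (global_subst (global_vars R) g) R.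
Let Bs := map (tau_star_body_elem (global_vars R)) (rbody R).

Lemma global_vars_body c : In (Cond c) (rbody R) -> incl (vars_cond c) (global_vars R).
Proof.
  intros Hc x Hx; apply in_or_app; right; apply in_flat_map; exists (Cond c); auto.
Qed.

Lemma global_vars_bound b X L t :
  In (Count b X L t) (rbody R) -> incl (vars_term t) (global_vars R).
Proof.
  intros Hc x Hx; apply in_or_app; right; apply in_flat_map; exists (Count b X L t); auto.
Qed.

Lemma fo_forces_body_elem w g h B : In B (rbody R) ->
  fo_forces v w g h (tau_star_body_elem (global_vars R) B) <->
  forces (plain v) w (tau_body_elem le (subst_body_elem (global_subst (global_vars R) g) B)).
Proof.
  intros HB; destruct B as [c|b X L t].
  - simpl; rewrite fo_forces_lift, fo_forces_tauB.
    rewrite subst_cond_global by (apply global_vars_body, HB); reflexivity.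
  - destruct (Hwf b X L t HB) as (HX & _ & Ht).
    apply (fo_forces_count _ X L g HX (Hpure b X L t HB) b t w h Ht).
    exact (global_vars_bound b X L t HB).
Qed.

Lemma fo_forces_body w g h :
  (forall F, In F Bs -> fo_forces v w g h F) <->
  forces (plain v) w (tau_body le (rbody (instance g))).
Proof.
  unfold tau_body; rewrite forces_ConjOver; simpl; split.
  - intros H B HB; apply in_map_iff in HB; destruct HB as (B0 & <- & HB).
    apply (fo_forces_body_elem w g h B0 HB), H, in_map, HB.
  - intros H F HF; apply in_map_iff in HF; destruct HF as (B & <- & HB).
    apply (fo_forces_body_elem w g h B HB), H, in_map, HB.
Qed.

Lemma instance_agree Zs g g' : agree_off Zs g g' ->
  (forall x, In x Zs -> ~ In x (global_vars R)) -> instance g' = instance g.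
Proof.
  intros Hg HZ; unfold instance; f_equal; apply functional_extensionality; intros x.
  unfold global_subst; destruct in_dec as [Hx|]; [|reflexivity].
  f_equal; apply Hg; intros HxZ; exact (HZ x HxZ Hx).
Qed.

Lemma global_vars_rule x : In x (global_vars R) -> In x (vars_rule R).
Proof.
  unfold global_vars, vars_rule; rewrite !in_app_iff, !in_flat_map.
  intros [Hx|([c|b X L t] & HB & Hx)]; [auto| |]; right.
  - exists (Cond c); auto.
  - exists (Count b X L t); split; [exact HB|]; rewrite !in_app_iff; auto.
Qed.

(** Basic and choice rules share this argument through [Q]. Quantifying universally over [Zs], with
    [val_tuple] among the premises, has the effect of the conjunction over all value tuples in the
    conclusion. *)
Lemma fo_forces_rule_head a (F : fo1) (Q : list precomp -> form patom) w :
  incl (vars_atom a) (global_vars R) ->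
  let Zs := seq (fresh (vars_rule R)) (length (aargs a)) in
  (forall w' g h, fo_forces v w' g h F <-> forces (plain v) w' (Q (map g Zs))) ->
  (forall g h, fo_forces v w g h (FImp (FConj (Bs ++ [val_tuple (aargs a) Zs])) F)) <->
  (forall g, forces (plain v) w
     (Impl (tau_body le (rbody (instance g)))
           (ConjOver (tuple_values (aargs (subst_atom (global_subst (global_vars R) g) a))) Q))).
Proof.
  intros Ha Zs HQ.
  assert (HZ : length Zs = length (aargs a)) by apply length_seq.
  assert (Hfresh : forall x, In x Zs -> ~ In x (global_vars R)).
  { intros x Hx Hg; exact (not_in_seq_fresh x _ _ (global_vars_rule x Hg) Hx). }
  assert (E : forall w' g h, fo_forces v w' g h (FConj (Bs ++ [val_tuple (aargs a) Zs])) <->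
    forces (plain v) w' (tau_body le (rbody (instance g))) /\
    tuple_values (aargs (subst_atom (global_subst (global_vars R) g) a)) (map g Zs)).
  { intros w' g h; rewrite fo_forces_Conj, <- (fo_forces_body w' g h).
    rewrite subst_atom_global by exact Ha; simpl.
    rewrite <- (fo_forces_val_tuple v w' g h (aargs a) Zs HZ); split.
    - intros H; split; [intros F' HF'|]; apply H, in_or_app; simpl; auto.
    - intros [H1 H2] F' HF'; apply in_app_or in HF'; destruct HF' as [HF'|[<-|[]]]; auto. }
  split.
  - intros H g w' Hw Hbody; apply forces_ConjOver; intros rs Hrs.
    (* The tuple [rs] becomes the value of [Zs], which is fresh for the rule, so the instance stays
       the same. *)
    destruct (agree_off_assign g Zs rs) as (g' & Hg & <-); [apply seq_NoDup| |].
    { rewrite (Forall2_len _ _ _ Hrs); simpl; rewrite length_map; symmetry; exact HZ. }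
    apply (HQ w' g' (fun _ => 0%Z)), (H g' (fun _ => 0%Z) w' Hw), E.
    rewrite (instance_agree Zs g g' Hg Hfresh); split; [exact Hbody|].
    rewrite subst_atom_global in * by exact Ha.
    erewrite subst_atom_ext; [exact Hrs|]; intros x Hx.
    apply (agree_off_ground_subst _ _ Zs _ Hg); intros HxZ; exact (Hfresh x HxZ (Ha x Hx)).
  - intros H g h; apply fo_forces_Imp; intros w' Hw Hbody; apply E in Hbody.
    destruct Hbody as [Hbody Hrs]; apply HQ.
    specialize (H g w' Hw Hbody); cbv beta in H.
    exact (proj1 (forces_ConjOver _ _ _ _) H _ Hrs).
Qed.

Lemma fo_forces_rule w g h :
  fo_forces v w g h (tau_star_rule R) <->
  forall R', is_instance R R' -> forces (plain v) w (tau_rule le R').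
Proof.
  transitivity (forall g, forces (plain v) w (tau_rule le (instance g))).
  2:{ split.
      - intros H R' [f ->]; exact (H f).
      - intros H f; apply H; exists f; reflexivity. }
  unfold tau_star_rule; rewrite fo_forces_universal_closure; unfold tau_rule.
  assert (Hhead : incl (vars_head (rhead R)) (global_vars R))
    by (intros x Hx; apply in_or_app; auto).
  cbn [instance rhead subst_rule].
  destruct (rhead R) as [a|a|]; cbn [subst_head].
  - apply (fo_forces_rule_head a _ (fun rs => Atom (apred a, rs))); [exact Hhead|].
    intros w' g' h'; unfold fo_forces, plain; simpl; rewrite map_map; reflexivity.
  - apply (fo_forces_rule_head a _
      (fun rs => Or (Atom (apred a, rs)) (Neg (Atom (apred a, rs))))); [exact Hhead|].
    intros w' g' h'; unfold fo_forces; simpl ground.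
    rewrite !forces_Or.
    assert (E : forall w'', v w'' (Plain (apred a),
                 map (gterm_eval g' h') (map GVar (seq (fresh (vars_rule R))
                   (length (aargs a))))) <->
               plain v w'' (apred a, map g' (seq (fresh (vars_rule R))
                   (length (aargs a))))).
    { intros w''; unfold plain; rewrite map_map; reflexivity. }
    apply or_iff_morphism; [apply E|].
    etransitivity; [apply (forces_Neg v)|]; rewrite forces_Neg.
    split; intros H w'' Hw HA; apply (H w'' Hw), E, HA.
  - split.
    + intros H f; apply forces_Neg; intros w' Hw HB.
      specialize (H f (fun _ => 0%Z)); rewrite fo_forces_Neg in H; apply (H w' Hw).
      apply fo_forces_Conj, fo_forces_body, HB.
    + intros H f h'; apply fo_forces_Neg; intros w' Hw HB.
      specialize (H f); rewrite forces_Neg in H; apply (H w' Hw).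
      apply (fo_forces_body w' f h'), fo_forces_Conj, HB.
Qed.

End OneRule.

Lemma forces_tau_star Pi w : MGC_program Pi ->
  forces v w (gr le (tau_star Pi)) <-> forces (plain v) w (tau le Pi).
Proof.
  intros HPi; unfold gr, tau; etransitivity; [apply fo_forces_Conj|].
  rewrite forces_ConjOver; split.
  - intros H R' (R & HR & HR'); destruct (HPi R HR) as [Hwf Hpure].
    refine (proj1 (fo_forces_rule R Hwf Hpure w _ _) _ R' HR').
    apply H, in_map, HR.
  - intros H F HF; apply in_map_iff in HF; destruct HF as (R & <- & HR).
    destruct (HPi R HR) as [Hwf Hpure]; apply fo_forces_rule; [exact Hwf|exact Hpure|].
    intros R' HR'; apply H; exists R; auto.
Qed.

End Rules.

(** * Extending an interpretation to the counting atoms *)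

(** A counting atom is evaluated by decoding its arguments into values of [V] and a bound; an
    argument list of the wrong length makes it false. *)
Definition expand_defs (u : bool -> patom -> Prop) (w : bool) (a : pred1 * list precomp) : Prop :=
  let count b X V F :=
    exists g r, snd a = map g V ++ [r] /\
      counts b (length X) r (satisfying u g (fun _ => 0%Z) X F) w in
  match fst a with
  | Plain p => u w (p, snd a)
  | Atleast X V F => count BGe X V F
  | Atmost X V F => count BLe X V F
  end.

Lemma expand_defs_count u b X V F args w :
  expand_defs u w (count_pred b X V F, args) <->
  exists g r, args = map g V ++ [r] /\
    counts b (length X) r (satisfying u g (fun _ => 0%Z) X F) w.
Proof. destruct b; reflexivity. Qed.

Lemma plain_expand_defs u : plain (expand_defs u) = u.
Proof.
  apply functional_extensionality; intros w; apply functional_extensionality; intros [p rs].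
  reflexivity.
Qed.

(** The condition [counts] is what a counting formula expresses, so it persists because forcing
    does. *)
Lemma expand_defs_monotone u : monotone u -> monotone (expand_defs u).
Proof.
  intros Hu [p args].
  assert (Hc : forall b m r X F g, m = length X ->
    counts b m r (satisfying u g (fun _ => 0%Z) X F) false ->
    counts b m r (satisfying u g (fun _ => 0%Z) X F) true).
  { intros b m r X F g ->; rewrite <- !(fo_forces_exists_bound).
    apply (forces_accessible u _ Hu), accessible_true. }
  destruct p as [p|X V F|X V F]; [apply Hu|..];
    intros (g & r & E & H); exists g, r; split; auto.
Qed.

Lemma expand_defs_model u : Defs_model (expand_defs u).
Proof.
  intros b X V F r Hok w g; rewrite plain_expand_defs, expand_defs_count; split.
  (* The assignment found by decoding agrees with [g] on [V], which is all that matters for an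
     admissible constant. *)
  - intros (g' & r' & E & H); apply app_inj_tail in E; destruct E as [E ->].
    apply (counts_ext b (length X) r' _ _ w) with (2 := H).
    intros w' xs Hxs; apply (satisfying_ext _ _ _ _ _ _ X V); auto.
    intros x Hx; exact (ext_in_map E x Hx).
  - intros H; exists g, r; auto.
Qed.

End Ground.

Theorem theorem2 (le : precomp -> precomp -> Prop) (Hle : precomp_order le)
  (Pi1 Pi2 : list rule) (H1 : MGC_program Pi1) (H2 : MGC_program Pi2) :
  strongly_equivalent (tau le Pi1) (tau le Pi2) <->
  HT_equivalent (gr_Defs le) (gr le (tau_star Pi1)) (gr le (tau_star Pi2)).
Proof.
  rewrite strongly_equivalent_iff_ht, HT_equivalent_iff; split.
  - intros H v Hv Hdefs; apply (Defs_model_iff le Hle v Hv) in Hdefs.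
    assert (Hp : monotone (plain v)) by (intros a; apply Hv).
    intros w; rewrite !(forces_tau_star le Hle v Hdefs) by assumption.
    destruct w; [|apply H, Hp].
    (* [ht_equivalent] compares formulas at the here world only. The there world of [plain v] is
       therefore viewed as the here world of a total interpretation. *)
    set (u := fun _ : bool => plain v true).
    assert (Hu : monotone u) by (intros a Ha; exact Ha).
    assert (E : forall F, forces (plain v) true F <-> forces u false F).
    { intros F; split; intros HF.
      - apply forces_total; [exact Hu|auto|]; apply (forces_true_eq (plain v)); auto.
      - apply (forces_true_eq u); [reflexivity|]; apply (forces_accessible u F Hu false); auto. }
    rewrite !E; apply H, Hu.
  - intros H u Hu.
    assert (Hm := expand_defs_monotone le Hle u Hu).
    assert (Hdefs := expand_defs_model le u).
    specialize (H _ Hm (proj2 (Defs_model_iff le Hle _ Hm) Hdefs) false).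
    rewrite !(forces_tau_star le Hle _ Hdefs), plain_expand_defs in H by assumption.
    exact H.
Qed.
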